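(* For $\alpha,\beta>-1$ and $m\in\mathbb{Z}_+$ let $$\psi_m^{(\alpha,\beta)}(x)=\frac{(-1)^m}{\sqrt{g_m^{(\alpha,\beta)}}}\,(1-\tanh x)^{(\alpha+1)/2}(1+\tanh x)^{(\beta+1)/2}\,P_m^{(\alpha,\beta)}(\tanh x),\qquad x\in\mathbb{R}.$$ Then all orthonormal systems $\{\varphi_m\}_{m\in\mathbb{Z}_+}$ in $L_2(\mathbb{R})$ of full-range form (defined in the context) with a skew-symmetric, tridiagonal, irreducible differentiation matrix are, up to an affine change of variables (and a global sign), exactly the systems $\{\psi_m^{(\alpha,\beta)}\}_{m\in\mathbb{Z}_+}$ with $\alpha,\beta>-1$. That is: (i) if $\{\varphi_m\}_{m\in\mathbb{Z}_+}$ is such a system, then there exist $\alpha,\beta>-1$, $a>0$, $c\in\mathbb{R}$ and $\epsilon\in\{-1,1\}$ such that $\varphi_m(x)=\epsilon\sqrt{a}\,\psi_m^{(\alpha,\beta)}(ax+c)$ for all $m\in\mathbb{Z}_+$ and $x\in\mathbb{R}$; (ii) for every $\alpha,\beta>-1$ the system $\{\psi_m^{(\alpha,\beta)}\}_{m\in\mathbb{Z}_+}$ is such a system, and the coefficients $b_m$ of its differentiation matrix are $$b_m=\sqrt{\frac{(m+1)(\alpha+m+1)(\beta+m+1)(\alpha+\beta+m+1)}{(\alpha+\beta+2m+1)(\alpha+\beta+2m+3)}},\qquad m\in\mathbb{Z}_+,$$ where for $m=0$ the quotient $(\alpha+\beta+m+1)/(\alpha+\beta+2m+1)$ is read as $1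$.
   Context: $\mathbb{Z}_+=\{0,1,2,\ldots\}$. All functions are real-valued. $P_m^{(\alpha,\beta)}$ is the $m$th Jacobi polynomial in the standard normalisation, and $g_m^{(\alpha,\beta)}=\int_{-1}^1(1-t)^\alpha(1+t)^\beta[P_m^{(\alpha,\beta)}(t)]^2\,dt$. Skew-symmetric, tridiagonal, irreducible differentiation matrix: the functions $\varphi_m$ are differentiable on $\mathbb{R}$ and there are real numbers $b_m>0$, $m\in\mathbb{Z}_+$ (positivity being the paper's normalisation), such that, with $b_{-1}=0$, $$\varphi_m'=-b_{m-1}\varphi_{m-1}+b_m\varphi_{m+1},\qquad m\in\mathbb{Z}_+ .$$ Full-range form: there exist - an absolutely continuous measure $W(t)\,dt$ on $(-1,1)$ ($W\ge 0$) with orthonormal polynomials $\{q_m\}_{m\in\mathbb{Z}_+}$, i.e. $q_m$ is a real polynomial of degree exactly $m$ (the leading coefficient may have either sign) and $\int_{-1}^1 q_mq_nW\,dt=\delta_{m,n}$; - a function $h:(-1,1)\to\mathbb{R}$ mapping onto $\mathbb{R}$, differentiable, with $h'$ measurable and positive; its inverse is denoted $H:\mathbb{R}\to(-1,1)$, and it is differentiable with $h'(t)H'(h(t))=1$; - a function $\theta:(-1,1)\to\mathbb{R}$ such that $t\mapsto\theta(t)\sqrt{W(t)/h'(t)}$ belongs to $L_\infty(-1,1)$; such that, with $\Theta(x)=\theta(H(x))H'(x)W(H(x))$, $$\varphi_m(x)=\Theta(x)\,q_m(H(x)),\qquad m\in\mathbb{Z}_+,\ x\in\mathbb{R}.$$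 (Equivalently, the expansion coefficients $\hat f_m=\int_{-\infty}^\infty f\varphi_m\,dx$ of $f\in L_2(\mathbb{R})$ satisfy $\hat f_m=\int_{-1}^1\theta(t)f(h(t))q_m(t)W(t)\,dt$.) *)

(* Defs.v *)
From HB Require Import structures.
From mathcomp Require Import all_boot all_order all_algebra.
From mathcomp Require Import all_classical all_reals all_analysis.

Set Implicit Arguments.
Unset Strict Implicit.
Unset Printing Implicit Defensive.

Import Order.TTheory GRing.Theory Num.Theory.
Import numFieldNormedType.Exports.

Local Open Scope classical_set_scope.
Local Open Scope ring_scope.

Section Jacobi.
Context {R : realType}.
Implicit Types (a b x : R) (m n k : nat).

Definition tanh x : R := (expR x - expR (- x)) / (expR x + expR (- x)).

Definition pochhammer a k : R := \prod_(i < k) (a + i%:R).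

(* Szego (4.21.2), DLMF 18.5.7; in particular jacobi a b n evaluates at 1 to
   (a + 1)_n / n`!, also when a + b + 1 = 0. *)
Definition jacobi a b n : {poly R} :=
  \sum_(k < n.+1)
    (pochhammer (n%:R + a + b + 1) k * pochhammer (a + k%:R + 1) (n - k) /
      (k`! * (n - k)`!)%:R) *: (2^-1 *: ('X - 1)) ^+ k.

Definition jacobi_norm2 a b m : R :=
  \int[lebesgue_measure]_(t in `]-1, 1[)
    ((1 - t) `^ a * (1 + t) `^ b * (jacobi a b m).[t] ^+ 2).

Definition psi a b m x : R :=
  (-1) ^+ m / Num.sqrt (jacobi_norm2 a b m) *
  (1 - tanh x) `^ ((a + 1) / 2) * (1 + tanh x) `^ ((b + 1) / 2) *
  (jacobi a b m).[tanh x].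

Definition jacobi_coeff a b m : R :=
  Num.sqrt ((m%:R + 1) * (a + m%:R + 1) * (b + m%:R + 1) /
            (a + b + 2 * m%:R + 3) *
            (if m == 0 then 1
             else (a + b + m%:R + 1) / (a + b + 2 * m%:R + 1))).

End Jacobi.

Section Systems.
Context {R : realType}.

(* The branch m = 0 renders the convention b_{-1} = 0. *)
Definition diff_matrix_coeffs (phi : nat -> R -> R) (b : nat -> R) : Prop :=
  (forall m, 0 < b m) /\
  (forall m (x : R), is_derive x 1 (phi m)
     (- (if m is k.+1 then b k * phi k x else 0) + b m * phi m.+1 x)).

Definition orthonormal_system (phi : nat -> R -> R) : Prop :=
  (forall m, phi m \in Lfun (@lebesgue_measure R) 2%:E) /\
  (forall m n, \int[@lebesgue_measure R]_x (phi m x * phi n x) = (m == n)%:R).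

Record orthonormal_polys (W : R -> R) (q : nat -> {poly R}) : Prop := {
  weight_measurable : measurable_fun `](-1 : R), 1[ W ;
  weight_ge0 : forall t : R, -1 < t < 1 -> 0 <= W t ;
  poly_degree : forall m, size (q m) = m.+1 ;
  poly_integrable : forall m n, (@lebesgue_measure R).-integrable `](-1 : R), 1[
    (fun t : R => ((q m).[t] * (q n).[t] * W t)%:E) ;
  poly_orthonormal : forall m n,
    \int[@lebesgue_measure R]_(t in `]-1, 1[) ((q m).[t] * (q n).[t] * W t)
      = (m == n)%:R }.

(* A function on (-1, 1) is a total function R -> R of which only the values
   on `]-1, 1[ are constrained; as this interval is open, derivatives at its
   points do not depend on the values outside. *)
Record range_map (h H : R -> R) : Prop := {
  h_onto : h @` `]-1, 1[ = [set: R] ;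
  h_derivable : forall t : R, -1 < t < 1 -> derivable h t 1 ;
  h_derive_measurable : measurable_fun `](-1 : R), 1[ h^`()%classic ;
  h_derive_gt0 : forall t : R, -1 < t < 1 -> 0 < h^`()%classic t ;
  H_range : forall x : R, -1 < H x < 1 ;
  hK : forall t : R, -1 < t < 1 -> H (h t) = t ;
  HK : forall x : R, h (H x) = x ;
  H_derivable : forall x : R, derivable H x 1 ;
  hH_derive : forall t : R, -1 < t < 1 ->
    h^`()%classic t * H^`()%classic (h t) = 1 }.

(* L_infty(-1, 1) is expressed through extension by zero outside (-1, 1). *)
Definition full_range_form (phi : nat -> R -> R) : Prop :=
  exists (W : R -> R) (q : nat -> {poly R}) (h H theta : R -> R),
    [/\ orthonormal_polys W q,
        range_map h H,
        (fun t : R =>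
           if -1 < t < 1 then theta t * Num.sqrt (W t / h^`()%classic t) else 0)
          \in Lfun (@lebesgue_measure R) +oo%E &
        forall m (x : R), phi m x =
          theta (H x) * H^`()%classic x * W (H x) * (q m).[H x]].

Definition admissible_system (phi : nat -> R -> R) : Prop :=
  [/\ orthonormal_system phi,
      full_range_form phi &
      exists b, diff_matrix_coeffs phi b].

End Systems.

(* Main.v *)
Require Import Defs.
From mathcomp Require Import all_boot all_order all_algebra ring lra.
From mathcomp Require Import all_classical all_reals all_analysis.
From mathcomp Require Import measurable_realfun ess_sup_inf.

Set Implicit Arguments.
Unset Strict Implicit.
Unset Printing Implicit Defensive.

Import Order.TTheory GRing.Theory Num.Theory.
Import numFieldNormedType.Exports.
Local Open Scope classical_set_scope.
Local Open Scope ring_scope.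

(** Write T = tanh x, so that dT/dx = 1 - T^2, and let
    w = (1-T)^((a+1)/2) (1+T)^((b+1)/2).  For a polynomial p one has
    (w p(T))' = w (R p)(T) with R p = (1-t^2) p' + L p and
    L = ((b+1)(1-t) - (a+1)(1+t)) / 2.

    The systems psi are admissible.  R raises the degree by one and, because
    (w^2 p q)' integrates to zero, is skew-symmetric for the Jacobi weight.  On
    Jacobi polynomials it acts by R P_n = u_n P_(n+1) - v_n P_(n-1), which is an
    identity between hypergeometric coefficients in powers of (t-1)/2
    (jacobi_ladder).  Orthogonality follows from the Jacobi differential equation
    (jacobi_ode, jacobi_orthogonal), and skew-symmetry applied to P_n and P_(n+1)
    gives u_n |P_(n+1)|^2 = v_(n+1) |P_n|^2 (raise_lower_norm).  After
    normalisation the two coefficients of the ladder therefore become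
    sqrt (u_n v_(n+1)), up to sign, which is the matrix element b_n.  The change of
    variables t = tanh x carries L_2 norms on (-1,1) to L_2 norms on the line
    (integral_substitution_onto).

    Conversely, let phi_m = Theta q_m(H) be admissible.  The equation for phi_0'
    reads Theta' = Theta L(H) with L of degree 1; as H is bounded, Theta cannot
    vanish anywhere without vanishing identically (linear_ode_zero).  Dividing the
    equation for phi_1' by Theta gives H' = Q(H) with Q of degree at most 2.  Since H
    maps the line onto (-1,1) and increases, it would reach an end point at a
    positive speed, hence leave the interval, unless Q vanishes at both ends
    (autonomous_ode_root1).  So Q = a (1-t^2), H = tanh (a x + c), and Theta is a
    constant times (1-H)^A (1+H)^B; square integrability of phi_0 forces A, B > 0
    (weight_tanh_integrable_exponents).  Thus phi_0 agrees up to sign with the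
    rescaled psi_0.  Finally phi_0 determines the whole system: phi_m' and phi_(m-1)
    give b_m phi_(m+1), and b_m > 0 is its norm (diff_matrix_unique). *)

(** * Jacobi polynomials: differential equation and ladder relation *)

Section JacobiAlgebra.
Context {R : realType}.
Implicit Types (a b x : R) (m n k : nat).

Lemma pochhammer0 x : pochhammer x 0 = 1.
Proof. by rewrite /pochhammer big_ord0. Qed.

Lemma pochhammerS x k : pochhammer x k.+1 = pochhammer x k * (x + k%:R).
Proof. by rewrite /pochhammer big_ord_recr. Qed.

Lemma pochhammerSl x k : pochhammer x k.+1 = x * pochhammer (x + 1) k.
Proof.
rewrite /pochhammer big_ord_recl addr0; congr (_ * _).
by apply: eq_bigr => i _; rewrite lift0 -[i.+1]add1n natrD addrA.
Qed.

Lemma pochhammer_gt0 x k : 0 < x -> 0 < pochhammer x k.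
Proof. by move=> x0; apply: prodr_gt0 => i _; rewrite ltr_wpDr. Qed.

(** In the variable y = (t - 1)/2 a Jacobi polynomial is a terminating
    hypergeometric series, so identities can be checked coefficient by coefficient. *)
Definition shifted_jacobi_coef a b n k : R :=
  pochhammer (n%:R + a + b + 1) k * pochhammer (a + k%:R + 1) (n - k) /
    (k`! * (n - k)`!)%:R.

Definition shifted_jacobi a b n : {poly R} :=
  \poly_(k < n.+1) shifted_jacobi_coef a b n k.

Lemma jacobi_shifted a b n :
  jacobi a b n = shifted_jacobi a b n \Po (2^-1 *: ('X - 1)).
Proof.
rewrite /shifted_jacobi poly_def linear_sum /=; apply: eq_bigr => k _.
by rewrite linearZ /= rmorphXn /= comp_polyX.
Qed.

Lemma factr_neq0 n : (n`!%:R : R) != 0.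
Proof. by rewrite pnatr_eq0 -lt0n fact_gt0. Qed.

(** The two-term recurrence of the hypergeometric series; it is the Jacobi
    differential equation read on coefficients. *)
Lemma shifted_jacobi_coefS a b n k : (k < n)%N ->
  (k%:R + 1) * (k%:R + a + 1) * shifted_jacobi_coef a b n k.+1 =
  (n%:R - k%:R) * (n%:R + a + b + 1 + k%:R) * shifted_jacobi_coef a b n k.
Proof.
move=> kn; rewrite /shifted_jacobi_coef.
have [d ->] : exists d, n = (k + d.+1)%N.
  by exists (n - k.+1)%N; rewrite addnS -addSn subnKC.
have -> : (k + d.+1 - k.+1)%N = d by rewrite addnS -addSn addKn.
rewrite addKn (pochhammerS _ k) (pochhammerSl _ d) !factS !natrM.
have -> : a + k.+1%:R + 1 = a + k%:R + 1 + 1 by rewrite -[k.+1]addn1 natrD; ring.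
rewrite !natrD -[k.+1]addn1 -[d.+1]addn1 !natrD.
have k1 : (k%:R + 1 : R) != 0 by rewrite natr1 pnatr_eq0.
have d1 : (d%:R + 1 : R) != 0 by rewrite natr1 pnatr_eq0.
field.
by rewrite k1 d1 !factr_neq0.
Qed.

Lemma coef_shifted_jacobi a b n k : (shifted_jacobi a b n)`_k =
  if (k < n.+1)%N then shifted_jacobi_coef a b n k else 0.
Proof. by rewrite coef_poly. Qed.

Lemma shifted_jacobi_ode a b n :
  'X * (1 + 'X) * (shifted_jacobi a b n)^`()^`() +
    ((a + 1)%:P + (a + b + 2) *: 'X) * (shifted_jacobi a b n)^`() =
  (n%:R * (n%:R + a + b + 1)) *: shifted_jacobi a b n.
Proof.
apply/polyP => k; set J := shifted_jacobi a b n.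
have -> : 'X * (1 + 'X) * J^`()^`() + ((a + 1)%:P + (a + b + 2) *: 'X) * J^`()
   = J^`()^`() * 'X + J^`()^`() * 'X * 'X + (a + 1) *: J^`() +
     (a + b + 2) *: (J^`() * 'X).
  by rewrite -!mul_polyC; ring.
rewrite !coefD !coefZ !coefMX !coef_deriv.
have E : (k%:R + 1) * (k%:R + a + 1) * J`_k.+1 =
    (n%:R - k%:R) * (n%:R + a + b + 1 + k%:R) * J`_k.
  rewrite !coef_shifted_jacobi !ltnS; case: ltngtP => kn; last 2 first.
  - by rewrite !mulr0.
  - by rewrite kn subrr mulr0 !mul0r.
  - by rewrite shifted_jacobi_coefS.
case: k E => [|[|k]] /= E.
- rewrite !mulr0 !add0r addr0 mulr1n; move: E.
  by rewrite !mulr0n !subr0 !add0r mul1r addr0 => ->.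
- apply/eqP; rewrite -subr_eq0; apply/eqP.
  transitivity ((1 + 1) * (1 + a + 1) * J`_2
      - (n%:R - 1) * (n%:R + a + b + 1 + 1) * J`_1); last by rewrite E; ring.
  ring.
- apply/eqP; rewrite -subr_eq0; apply/eqP.
  have K2 : k.+2%:R = k%:R + 1 + 1 :> R by rewrite -[k.+2]addn2 natrD; ring.
  have K1 : k.+1%:R = k%:R + 1 :> R by rewrite -[k.+1]addn1 natrD.
  have K3 : k.+3%:R = k%:R + 1 + 1 + 1 :> R by rewrite -[k.+3]addn3 natrD; ring.
  rewrite K2 in E.
  rewrite -(mulr_natr _ k.+2) -(mulr_natr J`_k.+2) -(mulr_natr J`_k.+3 k.+3).
  rewrite -(mulr_natr (_ * _) k.+1).
  rewrite K1.
  rewrite K3 K2.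
  transitivity ((k%:R + 1 + 1 + 1) * (k%:R + 1 + 1 + a + 1) * J`_k.+3
      - (n%:R - (k%:R + 1 + 1)) * (n%:R + a + b + 1 + (k%:R + 1 + 1)) * J`_k.+2).
    ring.
  by rewrite E; ring.
Qed.

(** The coefficients u_n and v_n of the ladder relation.  At n = 0 the quotient has
    equal numerator and denominator, both 0 when a + b = -1, hence the separate
    value 1. *)
Definition raise_coef a b n : R :=
  - ((n%:R + 1) * (if n == 0%N then 1 else
      (n%:R + a + b + 1) / (n%:R + a + b + 1 + n%:R))).

Definition lower_coef a b n : R :=
  - ((a + n%:R) * (b + n%:R) / (n%:R + a + b + 1 + n%:R)).

Lemma shifted_jacobi_coef_head a b n :
  shifted_jacobi_coef a b n 0 = pochhammer (a + 1) n / n`!%:R.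
Proof. by rewrite /shifted_jacobi_coef pochhammer0 subn0 fact0 !mul1r mul1n addr0. Qed.

Lemma shifted_jacobi_coef_lead a b n :
  shifted_jacobi_coef a b n n = pochhammer (n%:R + a + b + 1) n / n`!%:R.
Proof. by rewrite /shifted_jacobi_coef subnn pochhammer0 fact0 muln1 mulr1. Qed.

Lemma shifted_jacobi_coefD a b k d : shifted_jacobi_coef a b (k + d) k =
  pochhammer ((k + d)%:R + a + b + 1) k * pochhammer (a + k%:R + 1) d /
  (k`!%:R * d`!%:R).
Proof. by rewrite /shifted_jacobi_coef addKn natrM. Qed.

(** The ladder relation on the coefficient of y^(k+1).  For k < n all four terms are
    rational multiples of one product of two Pochhammer symbols, which leaves an
    identity of rational functions; the cases k = n and k = n + 1 are those where
    terms of lower degree drop out. *)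
Lemma shifted_jacobi_coef_ladder a b n k : -1 < a -> -1 < b ->
  - (a + 1 + 2 * k.+1%:R) * (shifted_jacobi a b n.+1)`_k.+1
  - (a + b + 2 * k.+1%:R) * (shifted_jacobi a b n.+1)`_k =
  raise_coef a b n.+1 * (shifted_jacobi a b n.+2)`_k.+1 -
  lower_coef a b n.+1 * (shifted_jacobi a b n)`_k.+1.
Proof.
move=> a1 b1.
set N := n.+1%:R + a + b + 1.
have nS : n.+1%:R = n%:R + 1 :> R by rewrite natr1.
have n0 : 0 <= n%:R :> R by [].
have f1 : 1`! = 1%N by [].
have N0 : N != 0 by rewrite /N nS; lra.
have Nn : N + n.+1%:R != 0 by rewrite /N nS; lra.
have kS m : m.+1%:R = m%:R + 1 :> R by rewrite natr1.
have mS0 m : (m%:R + 1 : R) != 0 by rewrite natr1 pnatr_eq0.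
have poch1 j : N * pochhammer (N + 1) j = pochhammer N j * (N + j%:R).
  by rewrite -pochhammerSl pochhammerS.
have NE : n.+2%:R + a + b + 1 = N + 1 by rewrite /N (kS n.+1); ring.
have NP : n%:R + a + b + 1 = N - 1 by rewrite /N nS; ring.
rewrite !coef_shifted_jacobi /raise_coef /lower_coef /= -/N.
have [kn|kn] := ltnP k n.
  have [d nE] : exists d, n = (k.+1 + d)%N by exists (n - k.+1)%N; rewrite subnKC.
  rewrite !ltnS (ltnW kn) (leqW (ltnW kn)) kn.
  have -> : shifted_jacobi_coef a b n.+1 k.+1 =
      pochhammer N k * (N + k%:R) * (pochhammer (a + k%:R + 1 + 1) d *
      (a + k%:R + 1 + 1 + d%:R)) /
      ((k%:R + 1) * k`!%:R * ((d%:R + 1) * d`!%:R)).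
    have := shifted_jacobi_coefD a b k.+1 d.+1.
    rewrite addnS -nE => ->.
    rewrite !pochhammerS (kS k) -/N !factS !natrM !natr1.
    by rewrite (kS k) (addrA a).
  have -> : shifted_jacobi_coef a b n.+1 k =
      pochhammer N k * ((a + k%:R + 1) * (pochhammer (a + k%:R + 1 + 1) d *
      (a + k%:R + 1 + 1 + d%:R))) /
      (k`!%:R * ((d%:R + 1 + 1) * ((d%:R + 1) * d`!%:R))).
    have := shifted_jacobi_coefD a b k d.+2.
    rewrite !addnS -addSn -nE => ->.
    by rewrite pochhammerSl pochhammerS -/N !factS !natrM -!natr1.
  have -> : shifted_jacobi_coef a b n.+2 k.+1 =
      pochhammer N k * (N + k%:R) * (N + k%:R + 1) / N *
      (pochhammer (a + k%:R + 1 + 1) d *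
      (a + k%:R + 1 + 1 + d%:R) * (a + k%:R + 1 + 1 + d%:R + 1)) /
      ((k%:R + 1) * k`!%:R * ((d%:R + 1 + 1) * ((d%:R + 1) * d`!%:R))).
    have := shifted_jacobi_coefD a b k.+1 d.+2.
    rewrite !addnS -nE => ->.
    rewrite NE; have -> : pochhammer (N + 1) k.+1 =
       pochhammer N k * (N + k%:R) * (N + k%:R + 1) / N.
      apply: (mulfI N0); rewrite poch1 pochhammerS (kS k); field.
      exact: N0.
    by rewrite !pochhammerS !factS !natrM !kS !addrA.
  have -> : shifted_jacobi_coef a b n k.+1 = (N - 1) * pochhammer N k *
      pochhammer (a + k%:R + 1 + 1) d / ((k%:R + 1) * k`!%:R * d`!%:R).
    have := shifted_jacobi_coefD a b k.+1 d.
    rewrite -nE => ->.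
    by rewrite NP pochhammerSl subrK !factS !natrM !kS !addrA.
  have -> : n.+1%:R = k%:R + d%:R + 1 + 1 :> R.
    by rewrite kS nE natrD kS; ring.
  have -> : b = N - (k%:R + d%:R + 1 + 1) - 1 - a.
    by rewrite /N kS nE natrD kS; ring.
  rewrite !kS; field.
  have -> : k%:R + d%:R + 1 + 1 = n.+1%:R :> R.
    by rewrite kS nE natrD kS; ring.
  by rewrite !factr_neq0 N0 Nn !mS0 natr1 mS0.
(* the polynomial of degree n has no term of degree n + 1 *)
have [->|kn'] := eqVneq k n.
  rewrite !ltnS leqnn leqnSn ltnn mulr0 subr0.
  have -> : shifted_jacobi_coef a b n.+1 n.+1 =
      pochhammer N n * (N + n%:R) / ((n%:R + 1) * n`!%:R).
    by rewrite shifted_jacobi_coef_lead pochhammerS -/N factS natrM kS.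
  have -> : shifted_jacobi_coef a b n.+1 n =
      pochhammer N n * (a + n%:R + 1) / n`!%:R.
    have := shifted_jacobi_coefD a b n 1.
    by rewrite addn1 pochhammerS pochhammer0 mul1r addr0 -/N f1 mulr1.
  have -> : shifted_jacobi_coef a b n.+2 n.+1 =
      pochhammer N n * (N + n%:R) * (N + n%:R + 1) / N * (a + n%:R + 1 + 1)
       / ((n%:R + 1) * n`!%:R).
    have := shifted_jacobi_coefD a b n.+1 1.
    rewrite addn1 NE => ->; have -> : pochhammer (N + 1) n.+1 =
       pochhammer N n * (N + n%:R) * (N + n%:R + 1) / N.
      apply: (mulfI N0); rewrite poch1 pochhammerS (kS n); field.
      exact: N0.
    by rewrite pochhammerS pochhammer0 mul1r addr0 f1 mulr1 factS natrM !kS !addrA.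
  have -> : b = N - (n%:R + 1) - 1 - a by rewrite /N kS; ring.
  rewrite !kS; rewrite kS in Nn; field.
  by rewrite factr_neq0 N0 Nn mS0.
(* leading coefficients *)
have [->|kn''] := eqVneq k n.+1.
  have -> : (n.+2 < n.+1)%N = false by rewrite ltnNge leqnSn.
  rewrite ltnn !ltnSn.
  rewrite !mulr0 subr0 sub0r !shifted_jacobi_coef_lead -/N NE.
  have -> : pochhammer (N + 1) n.+2 =
      pochhammer N n.+1 * (N + n.+1%:R) * (N + n.+2%:R) / N.
    apply: (mulfI N0); rewrite poch1 !pochhammerS; field.
    exact: N0.
  rewrite (factS n.+1) natrM.
  have -> : N = n%:R + 1 + a + b + 1 by rewrite /N kS.
  rewrite !kS; field.
  by rewrite factr_neq0 (natr1 n) mS0 -/N N0 Nn.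
have nk : (n.+1 < k)%N by rewrite ltn_neqAle eq_sym kn'' ltn_neqAle eq_sym kn'.
have -> : (k.+1 < n.+2)%N = false by rewrite ltnNge ltnS ltnW.
have -> : (k < n.+2)%N = false by rewrite ltnNge nk.
have -> : (k.+1 < n.+3)%N = false by rewrite ltnNge ltnS nk.
have -> : (k.+1 < n.+1)%N = false by rewrite ltnNge ltnS ltnW// ltnW.
by rewrite !mulr0.
Qed.

Lemma shifted_jacobi_ladder0 a b :
  - ((a + 1)%:P + (a + b + 2) *: 'X) * shifted_jacobi a b 0
  - 2 *: ('X * (1 + 'X) * (shifted_jacobi a b 0)^`()) =
  raise_coef a b 0 *: shifted_jacobi a b 1.
Proof.
have -> : shifted_jacobi a b 0 = 1.
  rewrite /shifted_jacobi poly_def big_ord1 shifted_jacobi_coef_head.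
  by rewrite pochhammer0 fact0 divr1 scale1r expr0.
have -> : shifted_jacobi a b 1 = (a + 1)%:P + (a + b + 2) *: 'X.
  rewrite /shifted_jacobi poly_def big_ord_recr big_ord1 /= expr0 expr1.
  rewrite shifted_jacobi_coef_head shifted_jacobi_coef_lead !pochhammerS !pochhammer0.
  rewrite !mul1r !addr0 (_ : 1`! = 1%N)// divr1 divr1 -alg_polyC; congr (_ + _ *: _).
  by rewrite -addrA addrC; ring.
rewrite derivC mulr0 scaler0 subr0 mulr1 /raise_coef /= add0r mulr1.
by rewrite scaleN1r.
Qed.

Lemma shifted_jacobi_ladder a b n : -1 < a -> -1 < b ->
  - ((a + 1)%:P + (a + b + 2) *: 'X) * shifted_jacobi a b n.+1
  - 2 *: ('X * (1 + 'X) * (shifted_jacobi a b n.+1)^`()) =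
  raise_coef a b n.+1 *: shifted_jacobi a b n.+2 -
  lower_coef a b n.+1 *: shifted_jacobi a b n.
Proof.
move=> a1 b1; apply/polyP => k; set J := shifted_jacobi a b n.+1.
have -> : - ((a + 1)%:P + (a + b + 2) *: 'X) * J - 2 *: ('X * (1 + 'X) * J^`()) =
   - (a + 1) *: J - (a + b + 2) *: (J * 'X) - 2 *: (J^`() * 'X)
   - 2 *: (J^`() * 'X * 'X).
  by rewrite -!mul_polyC polyCN; ring.
rewrite !coefD !coefN !coefZ !coefMX !coef_deriv.
case: k => [|k] /=.
  rewrite /J !coef_shifted_jacobi /= !shifted_jacobi_coef_head !pochhammerS.
  rewrite !factS !natrM -!natr1 /raise_coef /lower_coef /= -natr1.
  have n0 : 0 <= n%:R :> R by [].
  have N0 : n%:R + 1 + a + b + 1 + (n%:R + 1) != 0 by apply: lt0r_neq0; lra.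
  have m1 : (n%:R + 1 : R) != 0 by rewrite natr1 pnatr_eq0.
  have m2 : (n%:R + 1 + 1 : R) != 0 by rewrite !natr1 pnatr_eq0.
  field.
  by rewrite factr_neq0 m1 m2 N0.
rewrite -(shifted_jacobi_coef_ladder n k a1 b1) -/J -(mulr_natr _ k.+1) -natr1.
case: k => [|k] /=; first by ring.
by rewrite -(mulr_natr _ k.+1) -natr1; ring.
Qed.

(** The logarithmic derivative of (1-t)^(a+1) (1+t)^(b+1), multiplied by 1 - t^2;
    this is the 2L of the introduction. *)
Definition jacobi_drift a b : {poly R} :=
  (b + 1) *: (1 - 'X) - (a + 1) *: (1 + 'X).

(* The substitution y = (t - 1)/2, which carries the relations in y to relations
   in t. *)
Let l : {poly R} := 2^-1 *: ('X - 1).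

Let polyX_shift : 'X = 2%:P * l + 1.
Proof. by rewrite /l mul_polyC scalerA mulfV// scale1r subrK. Qed.

Let onem_sqr_shift : 1 - 'X^2 = - (2%:P * 2%:P) * (l * (1 + l)).
Proof. by rewrite {1}polyX_shift polyCD; ring. Qed.

Let jacobi_drift_shift a b :
  jacobi_drift a b = - 2%:P * ((a + 1)%:P + (a + b + 2)%:P * l).
Proof.
by rewrite /jacobi_drift {1 2}polyX_shift -!mul_polyC !polyCD polyC1; ring.
Qed.

Let half_poly : 2%:P * (2^-1)%:P = 1 :> {poly R}.
Proof. by rewrite -polyCM mulfV. Qed.

Let deriv_shift (p : {poly R}) : (p \Po l)^`() = (2^-1)%:P * (p^`() \Po l).
Proof.
rewrite deriv_comp mulrC; congr (_ * _).
by rewrite /l derivZ derivB derivX derivC subr0 alg_polyC.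
Qed.

Lemma jacobi_ode a b n :
  (1 - 'X^2) * (jacobi a b n)^`()^`() + jacobi_drift a b * (jacobi a b n)^`() =
  - (n%:R * (n%:R + a + b + 1)) *: jacobi a b n.
Proof.
rewrite jacobi_shifted -/l; set J := shifted_jacobi _ _ _.
have /(congr1 (fun p => p \Po l)) := shifted_jacobi_ode a b n.
rewrite -/J !linearD !rmorphM /= !comp_polyD !comp_polyZ !comp_polyC !comp_polyX.
rewrite -!mul_polyC => E.
rewrite polyCN mulNr -E.
rewrite deriv_shift derivM derivC mul0r add0r deriv_shift onem_sqr_shift.
rewrite jacobi_drift_shift.
transitivity (- (2%:P * (2^-1)%:P) ^+ 2 * (l * (1 + l)) * (J^`()^`() \Po l) -
  2%:P * (2^-1)%:P * ((a + 1)%:P + (a + b + 2)%:P * l) * (J^`() \Po l)); first by ring.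
by rewrite half_poly; ring.
Qed.

Let jacobi_ladder_shift a b (J : {poly R}) :
  (1 - 'X^2) * (J \Po l)^`() + 2^-1 *: (jacobi_drift a b * (J \Po l)) =
  (- ((a + 1)%:P + (a + b + 2) *: 'X) * J - 2 *: ('X * (1 + 'X) * J^`())) \Po l.
Proof.
rewrite mulNr -!mul_polyC comp_polyB raddfN /= -polyC1.
rewrite !(comp_polyM, comp_polyD, comp_polyC, comp_polyX) polyC1.
rewrite deriv_shift onem_sqr_shift jacobi_drift_shift.
transitivity (- 2%:P * (2%:P * (2^-1)%:P) * (l * (1 + l)) * (J^`() \Po l) -
  2%:P * (2^-1)%:P * ((a + 1)%:P + (a + b + 2)%:P * l) * (J \Po l)); first by ring.
by rewrite half_poly; ring.
Qed.

Lemma jacobi_ladder0 a b :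
  (1 - 'X^2) * (jacobi a b 0)^`() + 2^-1 *: (jacobi_drift a b * jacobi a b 0) =
  raise_coef a b 0 *: jacobi a b 1.
Proof.
by rewrite !jacobi_shifted jacobi_ladder_shift shifted_jacobi_ladder0 comp_polyZ.
Qed.

Lemma jacobi_ladder a b n : -1 < a -> -1 < b ->
  (1 - 'X^2) * (jacobi a b n.+1)^`() +
    2^-1 *: (jacobi_drift a b * jacobi a b n.+1) =
  raise_coef a b n.+1 *: jacobi a b n.+2 - lower_coef a b n.+1 *: jacobi a b n.
Proof.
move=> a1 b1; rewrite !jacobi_shifted jacobi_ladder_shift shifted_jacobi_ladder//.
by rewrite comp_polyB !comp_polyZ.
Qed.

Lemma size_jacobi a b n : -1 < a -> -1 < b -> size (jacobi a b n) = n.+1.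
Proof.
move=> a1 b1; rewrite jacobi_shifted -/l size_comp_poly2; last first.
  by rewrite /l size_scale ?invr_eq0// size_XsubC.
rewrite /shifted_jacobi size_poly_eq// shifted_jacobi_coef_lead.
rewrite mulf_neq0 ?invr_eq0 ?factr_neq0//.
case: n => [|n]; first by rewrite pochhammer0 oner_neq0.
apply/lt0r_neq0/pochhammer_gt0; rewrite -natr1.
by have : 0 <= n%:R :> R by []; lra.
Qed.

Lemma jacobi0 a b : jacobi a b 0 = 1.
Proof.
rewrite jacobi_shifted /shifted_jacobi poly_def big_ord1 shifted_jacobi_coef_head.
by rewrite pochhammer0 fact0 divr1 scale1r expr0 -polyC1 comp_polyC.
Qed.

Lemma raise_coef_lt0 a b n : -1 < a -> -1 < b -> raise_coef a b n < 0.
Proof.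
move=> a1 b1; rewrite oppr_lt0 mulr_gt0 ?ltr_wpDl//.
case: n => //= n; have n0 : 0 <= n%:R :> R by [].
by rewrite divr_gt0 // -natr1; lra.
Qed.

Lemma lower_coefS_lt0 a b n : -1 < a -> -1 < b -> lower_coef a b n.+1 < 0.
Proof.
move=> a1 b1; rewrite oppr_lt0; have n0 : 0 <= n%:R :> R by [].
by rewrite divr_gt0 ?mulr_gt0 // -natr1; lra.
Qed.

Lemma jacobi_coeffE a b n : -1 < a -> -1 < b ->
  jacobi_coeff a b n = Num.sqrt (raise_coef a b n * lower_coef a b n.+1).
Proof.
move=> a1 b1; congr Num.sqrt; rewrite /raise_coef /lower_coef.
case: n => [|n] /=; first by field; apply: lt0r_neq0; lra.
have n0 : 0 <= n%:R :> R by [].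
rewrite -!natr1; field.
by apply/andP; split; apply: lt0r_neq0; lra.
Qed.

End JacobiAlgebra.

(** * Integration on (-1, 1) by exhaustion *)

Section Exhaustion.
Context {R : realType}.
Notation mu := (@lebesgue_measure R).

Lemma is_derive_continuous (f : R -> R) (x df : R) :
  is_derive x 1 f df -> {for x, continuous f}.
Proof. by move=> [+ _] => /derivable1_diffP/differentiable_continuous. Qed.

(** Monotone convergence, applied to the positive and the negative part. *)
Lemma cvg_integral_exhaustion (D : set R) (S : nat -> set R) (f : R -> R) :
  measurable D -> (forall n, measurable (S n)) ->
  nondecreasing_seq S -> \bigcup_n S n = D ->
  mu.-integrable D (EFin \o f) ->
  (\int[mu]_(x in S n) f x) @[n --> \oo] --> \int[mu]_(x in D) f x.
Proof.
move=> mD mS ndS SD fi.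
have mf : measurable_fun D f by apply/measurable_EFinP; case/integrableP: fi.
have SsubD n : S n `<=` D by rewrite -SD; exact: bigcup_sup.
have fSi n : mu.-integrable (S n) (EFin \o f).
  exact: (@integrableS _ _ _ mu _ _ _ mD (mS n) (SsubD n) fi).
have pos g : mu.-integrable D (EFin \o g) -> (forall x, 0 <= g x) ->
    (\int[mu]_(x in S n) g x) @[n --> \oo] --> \int[mu]_(x in D) g x.
  move=> gi g0.
  have mg : measurable_fun D g by apply/measurable_EFinP; case/integrableP: gi.
  have gSi n : mu.-integrable (S n) (EFin \o g).
    by exact: (@integrableS _ _ _ mu _ _ _ mD (mS n) (SsubD n) gi).
  apply: fine_cvg; rewrite fineK ?integrable_fin_num// -SD.
  apply: ge0_nondecreasing_set_cvg_integral => //.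
  - by move=> n; apply/measurable_EFinP; exact: measurable_funS mg.
  - by move=> n x _; rewrite lee_fin.
have fE : f = (fun x => f^\+ x - f^\- x)%R.
  by rewrite -[LHS]funrposBneg.
have ip : mu.-integrable D (EFin \o f^\+) by exact: integrable_funrpos.
have im : mu.-integrable D (EFin \o f^\-) by exact: integrable_funrneg.
have E A : measurable A -> A `<=` D -> \int[mu]_(x in A) f x =
    \int[mu]_(x in A) (f^\+ x) - \int[mu]_(x in A) (f^\- x).
  move=> mA AD; rewrite {1}fE RintegralB//;
    exact: (@integrableS _ _ _ mu _ _ _ mD mA AD).
rewrite E//; under eq_fun => n do rewrite (E _ (mS n) (SsubD n)).
by apply: cvgB; apply: pos.
Qed.

(** Exhausting (-1, 1) from inside allows the fundamental theorem of calculus on each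
    compact segment although the integrands below may be singular at both ends. *)
Definition inner_radius (n : nat) : R := 1 - n.+2%:R^-1.

Lemma inner_radius_itv n : 0 < inner_radius n < 1.
Proof.
have H : 0 < n.+2%:R^-1 :> R by rewrite invr_gt0.
have H1 : n.+2%:R^-1 < 1 :> R by rewrite invf_lt1// ltr1n.
by rewrite /inner_radius; move: (n.+2%:R^-1) H H1 => e; lra.
Qed.

Definition inner_segment (n : nat) : set R :=
  `[- inner_radius n, inner_radius n]%classic.

Lemma inner_segmentP n t : inner_segment n t -> -1 < t < 1.
Proof. by have := inner_radius_itv n; rewrite /inner_segment /= in_itv /=; lra. Qed.

Lemma nondecreasing_inner_segment : nondecreasing_seq inner_segment.
Proof.
move=> m n mn; apply/subsetPset/subset_itv; rewrite bnd_simp.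
- by rewrite lerN2 lerB// lef_pV2 ?posrE// ler_nat !ltnS.
- by rewrite lerB// lef_pV2 ?posrE// ler_nat !ltnS.
Qed.

Lemma bigcup_inner_segment : \bigcup_n inner_segment n = `](-1), 1[%classic.
Proof.
apply/seteqP; split=> t.
  by move=> [n _ /inner_segmentP]; rewrite /= in_itv.
rewrite /= in_itv /= => t1.
have e0 : 0 < 1 - `|t| by rewrite subr_gt0 ltr_norml.
have [n _ /(_ n (leqnn n))] := near_infty_natSinv_lt (PosNum e0).
rewrite /= => H; exists n => //.
rewrite /inner_segment /= in_itv /= -ler_norml /inner_radius lerBrDr -lerBrDl.
rewrite (le_trans _ (ltW H))// lef_pV2 ?posrE// ler_nat.
by [].
Qed.

Lemma is_derive_oo_LRcontinuous (F f : R -> R) (c d : R) : c < d ->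
  (forall t, c <= t <= d -> is_derive t 1 F (f t)) ->
  derivable_oo_LRcontinuous F c d.
Proof.
move=> cd dF.
have cF t : c <= t <= d -> {for t, continuous F}.
  by move=> /dF; exact: is_derive_continuous.
split.
- move=> t /[!in_itv]/= /andP[ct td]; have ctd : c <= t <= d by rewrite !ltW.
  by have [] := dF t ctd.
- by apply: cvg_at_right_filter; apply: cF; rewrite lexx ltW.
- by apply: cvg_at_left_filter; apply: cF; rewrite lexx ltW.
Qed.

Lemma integral_derive_segment (F f : R -> R) (c d : R) : c < d ->
  (forall t, c <= t <= d -> {for t, continuous f}) ->
  (forall t, c <= t <= d -> is_derive t 1 F (f t)) ->
  (\int[mu]_(t in `[c, d]) (f t)%:E)%E = (F d - F c)%:E.
Proof.
move=> cd cf dF; rewrite (@continuous_FTC2 _ f F)//.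
- by apply: continuous_in_subspaceT => t; rewrite inE /= in_itv; exact: cf.
- exact: is_derive_oo_LRcontinuous dF.
- move=> t /[!in_itv]/= /andP[ct td]; have ctd : c <= t <= d by rewrite !ltW.
  by have [_ <-] := dF t ctd; rewrite derive1E.
Qed.

Lemma integral_derive_inner (F f : R -> R) n :
  (forall t : R, -1 < t < 1 -> is_derive t 1 F (f t)) ->
  (forall t : R, -1 < t < 1 -> {for t, continuous f}) ->
  (\int[mu]_(x in inner_segment n) (f x)%:E)%E =
    (F (inner_radius n) - F (- inner_radius n))%:E.
Proof.
move=> dF cf; have H := inner_radius_itv n.
apply: integral_derive_segment.
- by lra.
- by move=> t tn; apply: cf; lra.
- by move=> t tn; apply: dF; lra.
Qed.

Lemma Rintegral_derive0 (F f : R -> R) :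
  (forall t : R, -1 < t < 1 -> is_derive t 1 F (f t)) ->
  (forall t : R, -1 < t < 1 -> {for t, continuous f}) ->
  mu.-integrable `](-1), 1[ (EFin \o f) ->
  F (inner_radius n) @[n --> \oo] --> 0 ->
  F (- inner_radius n) @[n --> \oo] --> 0 ->
  \int[mu]_(t in `](-1)%R, 1%R[) f t = 0.
Proof.
move=> dF cf fi F1 FN1.
have mS n : measurable (inner_segment n) by exact: measurable_itv.
have := @cvg_integral_exhaustion _ inner_segment f (measurable_itv _) mS
  nondecreasing_inner_segment bigcup_inner_segment fi.
have E n : \int[mu]_(x in inner_segment n) f x =
    F (inner_radius n) - F (- inner_radius n).
  by rewrite /Rintegral (integral_derive_inner _ dF cf).
under eq_fun do rewrite E.
move=> H; apply: (cvg_unique _ H) => //.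
by rewrite -[0]subr0; exact: cvgB.
Qed.

(** The integrals over the inner segments are increments of F, hence bounded. *)
Lemma integrable_derive_bounded (F f : R -> R) (M : R) :
  (forall t : R, -1 < t < 1 -> is_derive t 1 F (f t)) ->
  (forall t : R, -1 < t < 1 -> {for t, continuous f}) ->
  (forall t : R, -1 < t < 1 -> 0 <= f t) ->
  (forall t : R, -1 < t < 1 -> `|F t| <= M) ->
  mu.-integrable `](-1), 1[ (EFin \o f).
Proof.
move=> dF cf f0 FM.
have mS n : measurable (inner_segment n) by exact: measurable_itv.
have mf : measurable_fun `](-1 : R), 1[ f.
  apply: open_continuous_measurable_fun; first exact: itv_open.
  by move=> t; rewrite inE /= in_itv; exact: cf.
apply/integrableP; split; first exact/measurable_EFinP.
under eq_integral.
  move=> t; rewrite inE /= in_itv /= => t1; rewrite ger0_norm ?f0//; over.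
rewrite /= -bigcup_inner_segment.
apply: (@le_lt_trans _ _ (M + M)%:E); last exact: ltry.
have H : (\int[mu]_(x in inner_segment n) (f x)%:E)%E @[n --> \oo] -->
    (\int[mu]_(x in \bigcup_n inner_segment n) (f x)%:E)%E.
  apply: ge0_nondecreasing_set_cvg_integral => //.
  - exact: nondecreasing_inner_segment.
  - move=> n; apply/measurable_EFinP; apply: measurable_funS mf => //.
    by move=> t /inner_segmentP; rewrite /= in_itv.
  - by move=> n t /inner_segmentP ?; rewrite lee_fin f0.
rewrite -(cvg_lim _ H)//; apply: lime_le; first by apply/cvg_ex; eexists; exact: H.
apply: nearW => n; rewrite (integral_derive_inner _ dF cf) lee_fin.
rewrite (le_trans (ler_norm _))//.
rewrite (le_trans (ler_normB _ _))// lerD// FM//; have := inner_radius_itv n; lra.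
Qed.

End Exhaustion.

(** * The Jacobi weight *)

Section WeightedIntegral.
Context {R : realType}.
Notation mu := (@lebesgue_measure R).
Implicit Types (a b t : R) (p : {poly R}).

Definition jacobi_weight a b t : R := (1 - t) `^ a * (1 + t) `^ b.

Lemma jacobi_weight_ge0 a b t : 0 <= jacobi_weight a b t.
Proof. by rewrite mulr_ge0 ?powR_ge0. Qed.

Lemma jacobi_weight_gt0 a b t : -1 < t < 1 -> 0 < jacobi_weight a b t.
Proof. by move=> /andP[? ?]; rewrite mulr_gt0 ?powR_gt0//; lra. Qed.

Lemma is_derive_powR_onem a t : t < 1 ->
  is_derive t 1 (fun t => (1 - t) `^ a) (- (a * (1 - t) `^ (a - 1))).
Proof.
move=> t1; have t0 : 0 < 1 - t by lra.
have H : is_derive ((cst 1 - id) t) 1 (@powR R ^~ a) (a * (1 - t) `^ (a - 1)).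
  exact: is_derive1_powR.
apply: (@trigger_derive _ ((@powR R ^~ a) \o (cst 1 - id))).
by rewrite sub0r mulrN1.
Qed.

Lemma is_derive_powR_onep a t : -1 < t ->
  is_derive t 1 (fun t => (1 + t) `^ a) (a * (1 + t) `^ (a - 1)).
Proof.
move=> t1; have t0 : 0 < 1 + t by lra.
have H : is_derive ((cst 1 + id) t) 1 (@powR R ^~ a) (a * (1 + t) `^ (a - 1)).
  exact: is_derive1_powR.
apply: (@trigger_derive _ ((@powR R ^~ a) \o (cst 1 + id))).
by rewrite add0r mulr1.
Qed.

Lemma powRSB1 x a : 0 < x -> x `^ (a + 1) = x `^ a * x :> R.
Proof.
by move=> x0; rewrite powRD ?powRr1// 1?ltW// (gt_eqF x0) implybT.
Qed.

(** Differentiating w^2 p lowers both exponents of the weight by one and acts on p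
    by a polynomial differential operator. *)
Lemma is_derive_weight_mul a b p t : -1 < t < 1 ->
  is_derive t 1 (fun t => jacobi_weight (a + 1) (b + 1) t * p.[t])
    (jacobi_weight a b t * ((1 - 'X^2) * p^`() + jacobi_drift a b * p).[t]).
Proof.
move=> /andP[t0 t1]; rewrite /jacobi_weight.
have H1 := is_derive_powR_onem (a + 1) t1.
have H2 := is_derive_powR_onep (b + 1) t0.
apply: (@trigger_derive _ (((fun t => (1 - t) `^ (a + 1)) *
   (fun t => (1 + t) `^ (b + 1))) * horner p)%R).
rewrite /jacobi_drift !hornerE /= /GRing.scale /= !addrK.
by rewrite mulrfctE !powRSB1; [ring|lra..].
Qed.

Lemma continuous_weight_mul a b p t : -1 < t < 1 ->
  {for t, continuous (fun t => jacobi_weight a b t * p.[t])}.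
Proof.
move=> /andP[t0 t1]; apply: continuousM; last exact: continuous_horner.
apply: continuousM.
- exact: is_derive_continuous (is_derive_powR_onem a t1).
- exact: is_derive_continuous (is_derive_powR_onep b t0).
Qed.

Lemma continuous_jacobi_weight a b t : -1 < t < 1 ->
  {for t, continuous (jacobi_weight a b)}.
Proof.
move=> t1.
have E : (fun t => jacobi_weight a b t * (1 : {poly R}).[t]) = jacobi_weight a b.
  by apply/funext => u; rewrite hornerE mulr1.
by rewrite -E; exact: continuous_weight_mul.
Qed.

Lemma powR_le_exp2 (x c : R) : 1 <= x <= 2 -> x `^ c <= 2 `^ `|c|.
Proof.
move=> /andP[x1 x2]; apply: (@le_trans _ _ (x `^ `|c|)).
  by rewrite ler_powR// ler_norm.
by rewrite ge0_ler_powR// nnegrE; lra.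
Qed.

(** The singularities of the weight at the two ends are each bounded by one term
    of the derivative of (1+t)^(b+1) - (1-t)^(a+1), a function that stays bounded. *)
Lemma integrable_jacobi_weight a b : -1 < a -> -1 < b ->
  mu.-integrable `](-1), 1[ (EFin \o jacobi_weight a b).
Proof.
move=> a1 b1.
pose G t := (1 + t) `^ (b + 1) - (1 - t) `^ (a + 1).
pose g t := (b + 1) * (1 + t) `^ b + (a + 1) * (1 - t) `^ a.
have dG (t : R) : -1 < t < 1 -> is_derive t 1 G (g t).
  move=> /andP[t0 t1].
  have H1 := is_derive_powR_onem (a + 1) t1.
  have H2 := is_derive_powR_onep (b + 1) t0.
  apply: (@trigger_derive _ ((fun t => (1 + t) `^ (b + 1)) -
     (fun t => (1 - t) `^ (a + 1)))).
  by rewrite /g !addrK opprK.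
have cg (t : R) : -1 < t < 1 -> {for t, continuous g}.
  move=> t1.
  apply: continuousD; (apply: continuousM; first exact: cst_continuous).
  - rewrite (_ : (fun t => (1 + t) `^ b) = jacobi_weight 0 b).
      exact: continuous_jacobi_weight.
    by apply/funext => u; rewrite /jacobi_weight powRr0 mul1r.
  - rewrite (_ : (fun t => (1 - t) `^ a) = jacobi_weight a 0).
      exact: continuous_jacobi_weight.
    by apply/funext => u; rewrite /jacobi_weight powRr0 mulr1.
have g0 (t : R) : -1 < t < 1 -> 0 <= g t.
  by move=> _; rewrite addr_ge0// mulr_ge0 ?powR_ge0//; lra.
have GM (t : R) : -1 < t < 1 -> `|G t| <= 2 `^ (b + 1) + 2 `^ (a + 1).
  move=> t1; rewrite (le_trans (ler_normB _ _))// !ger0_norm ?powR_ge0//.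
  by rewrite lerD// ge0_ler_powR ?nnegrE//; lra.
have gi := integrable_derive_bounded dG cg g0 GM.
pose C := 2 `^ `|b| / (a + 1) + 2 `^ `|a| / (b + 1).
have C1 : 0 <= 2 `^ `|b| / (a + 1) by rewrite divr_ge0 ?powR_ge0//; lra.
have C2 : 0 <= 2 `^ `|a| / (b + 1) by rewrite divr_ge0 ?powR_ge0//; lra.
have mD : measurable (`](-1 : R), 1[%classic) by exact: measurable_itv.
apply: (@le_integrable _ _ _ mu _ mD _ _ _ _ (@integrableZl _ _ _ mu _ mD C _ gi)).
  apply/measurable_EFinP; apply: open_continuous_measurable_fun; first exact: itv_open.
  by move=> t; rewrite inE /= in_itv; exact: continuous_jacobi_weight.
move=> t; rewrite /= in_itv /= => t1; rewrite lee_fin ger0_norm ?jacobi_weight_ge0//.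
rewrite ger0_norm; last by rewrite mulr_ge0 ?g0// addr_ge0.
have A1 : (a + 1)^-1 * (a + 1) = 1 by rewrite mulVf//; lra.
have B1 : (b + 1)^-1 * (b + 1) = 1 by rewrite mulVf//; lra.
have pa := powR_ge0 (1 - t) a; have pb := powR_ge0 (1 + t) b.
have ga : 0 <= (a + 1) * (1 - t) `^ a by apply: mulr_ge0 => //; lra.
have gb : 0 <= (b + 1) * (1 + t) `^ b by apply: mulr_ge0 => //; lra.
have [t0|t0] := leP 0 t.
- apply: (@le_trans _ _ (2 `^ `|b| / (a + 1) * ((a + 1) * (1 - t) `^ a))).
    rewrite /jacobi_weight mulrC mulrA -(mulrA _ _ (a + 1)) A1 mulr1 ler_wpM2r//.
    by apply: powR_le_exp2; lra.
  by rewrite ler_pM ?lerDl ?lerDr.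
- apply: (@le_trans _ _ (2 `^ `|a| / (b + 1) * ((b + 1) * (1 + t) `^ b))).
    rewrite /jacobi_weight mulrA -(mulrA _ _ (b + 1)) B1 mulr1 ler_wpM2r//.
    by apply: powR_le_exp2; lra.
  by rewrite ler_pM ?lerDl ?lerDr.
Qed.

Lemma poly_bounded p : exists M, forall t : R, -1 < t < 1 -> `|p.[t]| <= M.
Proof.
elim/poly_ind: p => [|p c [M HM]]; first by exists 0 => t _; rewrite horner0 normr0.
exists (M + `|c|) => t t1; rewrite !hornerE (le_trans (ler_normD _ _))//.
rewrite lerD2r normrM (le_trans _ (HM t t1))// ler_piMr// ler_norml; lra.
Qed.

Lemma integrable_weight_mul a b p : -1 < a -> -1 < b ->
  mu.-integrable `](-1), 1[ (EFin \o (fun t => jacobi_weight a b t * p.[t])).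
Proof.
move=> a1 b1; have mD : measurable (`](-1 : R), 1[%classic) by exact: measurable_itv.
apply: (@integrableMl _ _ _ mu _ mD _ (horner p) (integrable_jacobi_weight a1 b1)).
  2: have [M HM] := poly_bounded p; exists M; split; first exact: num_real.
  2: by move=> x Mx t; rewrite /= in_itv /= => t1; exact: le_trans (HM _ t1) (ltW Mx).
by apply: measurable_funTS; apply: continuous_measurable_fun; exact: continuous_horner.
Qed.

Definition jacobi_integral a b p : R :=
  \int[mu]_(t in `](-1)%R, 1%R[) (jacobi_weight a b t * p.[t]).

Lemma jacobi_integralD a b p q : -1 < a -> -1 < b ->
  jacobi_integral a b (p + q) = jacobi_integral a b p + jacobi_integral a b q.
Proof.
move=> a1 b1; rewrite -RintegralD//; [|exact: integrable_weight_mul..].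
by apply: eq_Rintegral => t _; rewrite hornerD mulrDr.
Qed.

Lemma jacobi_integralZ a b c p : -1 < a -> -1 < b ->
  jacobi_integral a b (c *: p) = c * jacobi_integral a b p.
Proof.
move=> a1 b1; rewrite -RintegralZl//; last exact: integrable_weight_mul.
by apply: eq_Rintegral => t _; rewrite hornerZ mulrCA.
Qed.

Lemma cvg_inner_radius : inner_radius n @[n --> \oo] --> (1 : R).
Proof.
rewrite -[1 in X in _ --> X]subr0; apply: cvgB; first exact: cvg_cst.
by have := @cvg_harmonic R; rewrite -(cvg_shiftS _).
Qed.

Lemma cvg_powR_inner_radius (c : R) : 0 < c ->
  (1 - inner_radius n) `^ c @[n --> \oo] --> (0 : R).
Proof.
move=> c0; apply: (cvg_at_rightP _ _ _).1 (powR_cvg0 c0) _ _; split.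
  by move=> n; rewrite /inner_radius subKr invr_gt0.
rewrite -[0 in X in _ --> X](subrr 1); apply: cvgB; first exact: cvg_cst.
exact: cvg_inner_radius.
Qed.

(** The integrand is the derivative of (1-t)^(a+1) (1+t)^(b+1) p, which vanishes at
    both ends as a + 1 and b + 1 are positive.  Orthogonality and the relation between
    norms are instances. *)
Lemma jacobi_integral_drift a b p : -1 < a -> -1 < b ->
  jacobi_integral a b ((1 - 'X^2) * p^`() + jacobi_drift a b * p) = 0.
Proof.
move=> a1 b1; have Ha : 0 < a + 1 by lra. have Hb : 0 < b + 1 by lra.
apply: (@Rintegral_derive0 _ (fun t => jacobi_weight (a + 1) (b + 1) t * p.[t])).
- by move=> t; exact: is_derive_weight_mul.
- by move=> t; exact: continuous_weight_mul.
- exact: integrable_weight_mul.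
- rewrite -[0 in X in _ --> X](mul0r (p.[1])); apply: cvgM; last first.
    apply: continuous_cvg; last exact: cvg_inner_radius.
    exact: continuous_horner.
  rewrite -[0 in X in _ --> X](mul0r ((1 + 1) `^ (b + 1))).
  apply: cvgM; first exact: cvg_powR_inner_radius.
  apply: (@continuous_cvg _ _ _ _ _ _ (fun t => (1 + t) `^ (b + 1)));
    last exact: cvg_inner_radius.
  have n11 : -1 < 1 :> R by lra.
  have [+ _] := is_derive_powR_onep (b + 1) n11.
  by move=> /derivable1_diffP/differentiable_continuous.
- rewrite -[0 in X in _ --> X](mul0r (p.[-1])); apply: cvgM; last first.
    apply: continuous_cvg; last by apply: cvgN; exact: cvg_inner_radius.
    exact: continuous_horner.
  rewrite -[0 in X in _ --> X](mulr0 ((1 - -1) `^ (a + 1))).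
  apply: cvgM; last exact: cvg_powR_inner_radius.
  apply: (@continuous_cvg _ _ _ _ _ _ (fun t => (1 - t) `^ (a + 1))).
    have n11 : -1 < 1 :> R by lra.
    have [+ _] := is_derive_powR_onem (a + 1) n11.
    by move=> /derivable1_diffP/differentiable_continuous.
  by apply: cvgN; exact: cvg_inner_radius.
Qed.

End WeightedIntegral.

(** * Orthogonality and norms of Jacobi polynomials *)

Section Orthogonality.
Context {R : realType}.
Notation mu := (@lebesgue_measure R).
Implicit Types (a b : R) (m n : nat) (p q : {poly R}).

Lemma jacobi_integralB a b p q : -1 < a -> -1 < b ->
  jacobi_integral a b (p - q) = jacobi_integral a b p - jacobi_integral a b q.
Proof.
move=> a1 b1.
by rewrite -scaleN1r jacobi_integralD// jacobi_integralZ// mulN1r.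
Qed.

(** The Wronskian-like polynomial P_m' P_n - P_m P_n' turns the difference of the two
    differential equations into a multiple of P_m P_n; the eigenvalues differ by
    (n - m)(n + m + a + b + 1), and the second factor is positive unless m = n = 0. *)
Lemma jacobi_orthogonal a b m n : -1 < a -> -1 < b -> m != n ->
  jacobi_integral a b (jacobi a b m * jacobi a b n) = 0.
Proof.
move=> a1 b1 mn; have nm : (0 < n + m)%N.
  by case: m n mn => [|m] [|n]// _; rewrite addnS.
set P := jacobi a b m; set Q := jacobi a b n.
have := jacobi_integral_drift (P^`() * Q - P * Q^`()) a1 b1.
have -> : (1 - 'X^2) * (P^`() * Q - P * Q^`())^`() +
    jacobi_drift a b * (P^`() * Q - P * Q^`()) =
   (n%:R * (n%:R + a + b + 1) - m%:R * (m%:R + a + b + 1)) *: (P * Q).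
  have EP := jacobi_ode a b m; have EQ := jacobi_ode a b n.
  rewrite -!/P in EP; rewrite -!/Q in EQ; rewrite derivB !derivM.
  transitivity (((1 - 'X^2) * P^`()^`() + jacobi_drift a b * P^`()) * Q -
     P * ((1 - 'X^2) * Q^`()^`() + jacobi_drift a b * Q^`())).
    by ring.
  by rewrite EP EQ -!mul_polyC !polyCN polyCB; ring.
rewrite jacobi_integralZ// => /eqP; rewrite mulf_eq0 => /orP[|/eqP//].
have -> : n%:R * (n%:R + a + b + 1) - m%:R * (m%:R + a + b + 1) =
  (n%:R - m%:R) * (n%:R + m%:R + a + b + 1) by ring.
rewrite mulf_eq0 subr_eq0 eqr_nat eq_sym (negbTE mn) /= => /eqP H; exfalso.
have : 1 <= (n + m)%:R :> R by rewrite ler1n.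
by rewrite natrD; lra.
Qed.

(** Skew-symmetry of the ladder operator, tested on P_n and P_(n+1): the terms in
    P_(n-1) P_(n+1) and P_n P_(n+2) disappear by orthogonality. *)
Lemma raise_lower_norm a b n : -1 < a -> -1 < b ->
  raise_coef a b n * jacobi_integral a b (jacobi a b n.+1 ^+ 2) =
  lower_coef a b n.+1 * jacobi_integral a b (jacobi a b n ^+ 2).
Proof.
move=> a1 b1.
have := jacobi_integral_drift (jacobi a b n * jacobi a b n.+1) a1 b1.
have -> : (1 - 'X^2) * (jacobi a b n * jacobi a b n.+1)^`() +
    jacobi_drift a b * (jacobi a b n * jacobi a b n.+1) =
   ((1 - 'X^2) * (jacobi a b n)^`() + 2^-1 *: (jacobi_drift a b * jacobi a b n)) *
     jacobi a b n.+1 +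
   jacobi a b n * ((1 - 'X^2) * (jacobi a b n.+1)^`() +
     2^-1 *: (jacobi_drift a b * jacobi a b n.+1)).
  have h : jacobi_drift a b = 2^-1 *: jacobi_drift a b + 2^-1 *: jacobi_drift a b.
    have h2 : 2^-1 + 2^-1 = 1 :> R by field.
    by rewrite -scalerDl h2 scale1r.
  by rewrite {1}h derivM -!mul_polyC; ring.
rewrite (jacobi_ladder n a1 b1).
rewrite jacobi_integralD// mulrBr -!scalerAr jacobi_integralB// !jacobi_integralZ//.
have ortho k : jacobi_integral a b (jacobi a b k * jacobi a b k.+2) = 0.
  by apply: jacobi_orthogonal; rewrite // neq_ltn leqnSn.
rewrite ortho mulr0 sub0r.
have finish (x y : R) : x - y = 0 -> x = y by move/eqP; rewrite subr_eq0 => /eqP.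
case: n => [|n].
  rewrite jacobi_ladder0 -scalerAl jacobi_integralZ// -!expr2 => E.
  by apply: finish.
rewrite (jacobi_ladder n a1 b1).
rewrite mulrBl -!scalerAl jacobi_integralB// !jacobi_integralZ//.
rewrite ortho mulr0 subr0 -!expr2.
by move=> E; apply: finish.
Qed.

(** For n = 0 the weight is positive on a set of positive measure; the signs of the
    ladder coefficients propagate positivity to all n. *)
Lemma jacobi_integral_sqr_gt0 a b n : -1 < a -> -1 < b ->
  0 < jacobi_integral a b (jacobi a b n ^+ 2).
Proof.
move=> a1 b1; elim: n => [|n IH].
  rewrite lt_neqAle Rintegral_ge0 ?andbT; last first.
    by move=> t _; rewrite mulr_ge0 ?jacobi_weight_ge0// horner_exp sqr_ge0.
  rewrite jacobi0 expr1n eq_sym; apply/negP => /eqP J0.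
  have mD : measurable (`](-1 : R), 1[%classic) by exact: measurable_itv.
  have Wi := integrable_jacobi_weight a1 b1.
  have I0 : (\int[mu]_(x in `](-1)%R, 1%R[) `|(EFin \o jacobi_weight a b) x| = 0)%E.
    transitivity ((jacobi_integral a b 1)%:E); last by rewrite J0.
    rewrite /jacobi_integral fineK; last first.
      by apply: integrable_fin_num => //; exact: integrable_weight_mul.
    apply: eq_integral => t _ /=.
    by rewrite ger0_norm ?jacobi_weight_ge0// hornerE mulr1.
  have [N [mN N0 DN]] := (ae_eq_integral_abs mu mD (measurable_int mu Wi)).1 I0.
  have : (mu `](-1)%R, 1%R[ <= mu N)%E.
    apply: le_measure; rewrite ?inE// => t Dt; apply: DN => /= /(_ Dt) [].
    by apply/eqP; rewrite gt_eqF// jacobi_weight_gt0//; move: Dt; rewrite /= in_itv.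
  have n11 : (-1 < 1 :> R) by lra.
  rewrite N0 lebesgue_measure_itv /= lte_fin n11 -EFinD lee_fin.
  lra.
rewrite -(pmulr_rgt0 _ (_ : 0 < - raise_coef a b n)) ?oppr_gt0 ?raise_coef_lt0//.
by rewrite mulNr raise_lower_norm// -mulNr pmulr_rgt0// oppr_gt0 lower_coefS_lt0.
Qed.

Lemma jacobi_norm2E a b n :
  jacobi_norm2 a b n = jacobi_integral a b (jacobi a b n ^+ 2).
Proof. by apply: eq_Rintegral => t _; rewrite horner_exp. Qed.

End Orthogonality.

(** * Increasing maps of the line onto (-1, 1) *)

Section Substitution.
Context {R : realType}.
Notation mu := (@lebesgue_measure R).

Lemma is_derive_lt (F dF : R -> R) : (forall x : R, is_derive x 1 F (dF x)) ->
  (forall x, 0 < dF x) -> {homo F : x y / x < y}.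
Proof.
move=> HF dF0 x y xy; apply: (@gtr0_derive1_incr _ F x y) => //.
- by move=> z _; case: (HF z) => _; rewrite derive1E => ->.
- by apply: continuous_subspaceT => z; exact: is_derive_continuous (HF z).
Qed.

Lemma is_derive_le (F dF : R -> R) : (forall x : R, is_derive x 1 F (dF x)) ->
  (forall x, 0 <= dF x) -> {homo F : x y / x <= y}.
Proof.
move=> HF dF0 x y xy; apply: (@ger0_derive1_ndecr _ F x y) => //.
- by move=> z _; case: (HF z) => _; rewrite derive1E => ->.
- by apply: continuous_subspaceT => z; exact: is_derive_continuous (HF z).
Qed.

Variables (H dH : R -> R).
Hypothesis HH : forall x : R, is_derive x 1 H (dH x).
Hypothesis dH0 : forall x, 0 < dH x.
Hypothesis cdH : continuous dH.
Hypothesis H1 : forall x, -1 < H x < 1.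
Hypothesis Honto : forall t : R, -1 < t < 1 -> exists x, H x = t.

Let derive1H : H^`()%classic = dH.
Proof. by apply/funext => x; case: (HH x) => _ <-; rewrite derive1E. Qed.

Let itvR (n : nat) : set R := `[- n.+1%:R, n.+1%:R]%classic.
Let itvH (n : nat) : set R := `[H (- n.+1%:R), H (n.+1%:R)]%classic.

Let n0 (n : nat) : 0 < n.+1%:R :> R. Proof. by []. Qed.

Let bigcup_itvR : \bigcup_n itvR n = setT.
Proof.
apply/seteqP; split => // x _; exists (Num.truncn `|x|) => //.
by rewrite /itvR /= in_itv /= -ler_norml ltW// truncnS_gt.
Qed.

Let homoH : {homo H : x y / x < y} := is_derive_lt HH dH0.
Let homoHle : {homo H : x y / x <= y} := is_derive_le HH (fun x => ltW (dH0 x)).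

Let bigcup_itvH : \bigcup_n itvH n = `](-1), 1[%classic.
Proof.
apply/seteqP; split => [t [n _]|t]; rewrite /itvH /= !in_itv /=.
  have /andP[h1 h2] := H1 (- n.+1%:R); have /andP[h3 h4] := H1 (n.+1%:R).
  by move=> /andP[h5 h6]; rewrite (lt_le_trans h1 h5) (le_lt_trans h6 h4).
move=> /Honto[x <-]; have : [set: R] x by [].
rewrite -bigcup_itvR => -[n _]; rewrite /itvR /= in_itv /= => /andP[xn nx].
by exists n => //; rewrite /itvH /= in_itv /= !homoHle.
Qed.

Let nondecreasing_itvR : nondecreasing_seq itvR.
Proof.
move=> m n mn; apply/subsetPset/subset_itv; rewrite bnd_simp.
- by rewrite lerN2 ler_nat ltnS.
- by rewrite ler_nat ltnS.
Qed.

Let nondecreasing_itvH : nondecreasing_seq itvH.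
Proof.
move=> m n mn; apply/subsetPset/subset_itv; rewrite bnd_simp; apply: homoHle.
- by rewrite lerN2 ler_nat ltnS.
- by rewrite ler_nat ltnS.
Qed.

(** Both integrals are limits over matching exhaustions: [-n, n] on the line and its
    image [H (-n), H n] in (-1, 1), on which the substitution is classical. *)
Lemma ge0_integral_substitution_onto (f : R -> R) :
  (forall t : R, -1 < t < 1 -> {for t, continuous f}) ->
  (forall t, 0 <= f t) ->
  (\int[mu]_(t in `](-1)%R, 1%R[) (f t)%:E = \int[mu]_x (f (H x) * dH x)%:E)%E.
Proof.
move=> cf f0.
have cfH : continuous (fun x => f (H x) * dH x).
  move=> x; apply: continuousM; last exact: cdH.
  apply: (@continuous_comp _ _ _ H f); first exact: is_derive_continuous (HH x).
  exact: cf.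
have mf : measurable_fun `](-1 : R), 1[ f.
  apply: open_continuous_measurable_fun; first exact: itv_open.
  by move=> t; rewrite inE /= in_itv; exact: cf.
have L : (\int[mu]_(t in itvH n) (f t)%:E)%E @[n --> \oo] -->
    (\int[mu]_(t in `](-1)%R, 1%R[) (f t)%:E)%E.
  rewrite -bigcup_itvH; apply: ge0_nondecreasing_set_cvg_integral => //.
  - by move=> n; exact: measurable_itv.
  - move=> n; apply/measurable_EFinP.
    apply: measurable_funS mf => //.
    by rewrite -bigcup_itvH; exact: bigcup_sup.
  - by move=> n t _; rewrite lee_fin.
have : (\int[mu]_(t in itvH n) (f t)%:E)%E @[n --> \oo] -->
    (\int[mu]_x (f (H x) * dH x)%:E)%E.
  have -> : (fun n => (\int[mu]_(t in itvH n) (f t)%:E)%E) =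
     (fun n => (\int[mu]_(x in itvR n) (f (H x) * dH x)%:E)%E).
    apply/funext => n; rewrite /itvH /itvR.
    have nn : - n.+1%:R < n.+1%:R :> R by rewrite gtrN.
    rewrite (@integration_by_substitution_increasing _ H f) ?derive1H//.
    - exact: ltW.
    - by move=> x y _ _; exact: homoH.
    - exact: (cvgP _ (cvg_at_right_filter (@cdH _))).
    - exact: (cvgP _ (cvg_at_left_filter (@cdH _))).
    - by apply: is_derive_oo_LRcontinuous => // x _; exact: HH.
    - apply: continuous_in_subspaceT => t; rewrite inE => ht; apply: cf.
      have : (\bigcup_n itvH n) t by exists n.
      by rewrite bigcup_itvH /= in_itv.
  rewrite -bigcup_itvR; apply: ge0_nondecreasing_set_cvg_integral => //.
  - by move=> n; exact: measurable_itv.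
  - move=> n; apply/measurable_EFinP; apply: measurable_funTS.
    exact: continuous_measurable_fun.
  - by move=> n x _; rewrite lee_fin mulr_ge0// ltW.
exact: cvg_unique L.
Qed.

Lemma integral_substitution_onto (f : R -> R) :
  (forall t : R, -1 < t < 1 -> {for t, continuous f}) ->
  (\int[mu]_(t in `](-1)%R, 1%R[) (f t)%:E = \int[mu]_x (f (H x) * dH x)%:E)%E.
Proof.
move=> cf; rewrite integralE [RHS]integralE.
have fp (g : R -> R) x : (g^\+)%R (H x) * dH x = ((fun x => g (H x) * dH x)^\+)%R x.
  by rewrite /funrpos maxr_pMl ?mul0r// ltW.
have fn (g : R -> R) x : (g^\-)%R (H x) * dH x = ((fun x => g (H x) * dH x)^\-)%R x.
  by rewrite /funrneg maxr_pMl ?mul0r ?mulNr// ltW.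
congr (_ - _)%E.
  rewrite funerpos ge0_integral_substitution_onto;
    last by move=> t; rewrite le_max lexx orbT.
    by rewrite funerpos; apply: eq_integral => x _; rewrite /= fp.
  by move=> t t1; apply: continuous_max; [exact: cf|exact: cst_continuous].
rewrite funerneg ge0_integral_substitution_onto;
  last by move=> t; rewrite le_max lexx orbT.
  by rewrite funerneg; apply: eq_integral => x _; rewrite /= fn.
move=> t t1; apply: continuous_max; last exact: cst_continuous.
by apply: continuousN; exact: cf.
Qed.

Lemma integrable_substitution_onto (f : R -> R) :
  (forall t : R, -1 < t < 1 -> {for t, continuous f}) ->
  mu.-integrable `](-1), 1[ (EFin \o f) ->
  mu.-integrable setT (EFin \o (fun x => f (H x) * dH x)).
Proof.
move=> cf /integrableP[_ fi]; apply/integrableP; split.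
  apply/measurable_EFinP; apply: continuous_measurable_fun.
  move=> x; apply: continuousM; last exact: cdH.
  apply: (@continuous_comp _ _ _ H f); first exact: is_derive_continuous (HH x).
  exact: cf.
have E : (\int[mu]_(x in `](-1)%R, 1%R[) `|(EFin \o f) x| =
    \int[mu]_x `|(EFin \o (fun x => f (H x) * dH x)%R) x|)%E.
  rewrite /= (@integral_substitution_onto (fun t => `|f t|)).
    by apply: eq_integral => x _ /=; rewrite normrM (gtr0_norm (dH0 x)).
  move=> t t1; apply: (@continuous_comp _ _ _ f (fun x : R => `|x|)); first exact: cf.
  exact: norm_continuous.
by rewrite -E.
Qed.

End Substitution.

(** * The hyperbolic tangent *)

Section HyperbolicTangent.
Context {R : realType}.
Implicit Types (x t k c : R).

Lemma tanhE x : tanh x = (expR (2 * x) - 1) / (expR (2 * x) + 1).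
Proof.
have e0 := expR_gt0 x; have -> : 2 * x = x + x by ring.
rewrite /tanh expRD expRN; move: (expR x) e0 => e e0.
have ee : 0 < e * e by exact: mulr_gt0.
by field; rewrite !gt_eqF//; exact: addr_gt0.
Qed.

Lemma tanh_itv x : -1 < tanh x < 1.
Proof.
rewrite tanhE; have := expR_gt0 (2 * x); move: (expR _) => e e0.
by rewrite ltr_pdivlMr ?ltr_pdivrMr; lra.
Qed.

Lemma is_derive_tanh x : is_derive x 1 tanh (1 - tanh x ^+ 2).
Proof.
have e0 := expR_gt0 x; have e1 := expR_gt0 (- x).
have H1 : is_derive x 1 (fun x => expR (- x)) (- expR (- x)).
  have H : is_derive (- x) 1 (@expR R) (expR (- x)) by exact: is_derive_expR.
  have := @is_derive1_comp _ (@expR R) (fun y => - y) x _ _ H (is_deriveNid x 1).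
  by rewrite mulrN1.
have H0 := is_derive_expR x.
have H2 : is_derive x 1 (fun x => (expR x + expR (- x))^-1)
    (- (expR x + expR (- x)) ^- 2 * (expR x - expR (- x))).
  apply: is_deriveV; first by rewrite gt_eqF// addr_gt0.
have H3 := @is_deriveB _ _ _ _ _ _ _ _ _ H0 H1.
have E : @tanh R = (expR - (fun x => expR (- x))) * (fun x => (expR x + expR (- x))^-1).
  by apply/funext.
rewrite {1}E; apply: (is_derive_eq (@is_deriveM _ _ _ _ _ _ _ _ H3 H2)).
rewrite /tanh /GRing.scale /= !fctE; field.
by rewrite gt_eqF// addr_gt0.
Qed.

Definition artanh t : R := ln ((1 + t) / (1 - t)) / 2.

Lemma tanhK x : artanh (tanh x) = x.
Proof.
rewrite /artanh tanhE; have e0 := expR_gt0 (2 * x).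
have -> : (1 + (expR (2 * x) - 1) / (expR (2 * x) + 1)) /
   (1 - (expR (2 * x) - 1) / (expR (2 * x) + 1)) = expR (2 * x).
  by field; rewrite !gt_eqF//; lra.
by rewrite expRK; field.
Qed.

Lemma artanhK t : -1 < t < 1 -> tanh (artanh t) = t.
Proof.
move=> t1; have E2 (y : R) : 2 * (y / 2) = y by field.
rewrite tanhE /artanh E2 lnK; last first.
  by rewrite posrE divr_gt0//; lra.
field.
by apply/andP; split; apply/eqP; lra.
Qed.

Lemma is_derive_artanh t : -1 < t < 1 -> is_derive t 1 artanh ((1 - t ^+ 2)^-1).
Proof.
move=> t1; have p0 : 0 < 1 + t by lra. have m0 : 0 < 1 - t by lra.
have H1 : is_derive t 1 (fun t => ln (1 + t)) ((1 + t)^-1).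
  have H : is_derive ((cst 1 + id) t) 1 (@ln R) (1 + t)^-1 by exact: is_derive1_ln.
  by apply: (@trigger_derive _ (@ln R \o (cst 1 + id))); rewrite add0r mulr1.
have H2 : is_derive t 1 (fun t => ln (1 - t)) (- (1 - t)^-1).
  have H : is_derive ((cst 1 - id) t) 1 (@ln R) (1 - t)^-1 by exact: is_derive1_ln.
  by apply: (@trigger_derive _ (@ln R \o (cst 1 - id))); rewrite sub0r mulrN1.
have H3 : is_derive t 1 (fun t => 2^-1 * (ln (1 + t) - ln (1 - t))) ((1 - t ^+ 2)^-1).
  apply: (@trigger_derive _ (2^-1 \*: ((fun t => ln (1 + t)) - (fun t => ln (1 - t))))).
  rewrite /GRing.scale /=; field.
  by apply/and3P; split; apply/eqP; nra.
apply: near_eq_is_derive H3.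
near=> z; rewrite /artanh mulrC ln_div// posrE.
- have : -1 < z by near: z; apply: lt_nbhsr; lra.
  by lra.
- have : z < 1 by near: z; apply: lt_nbhsl; lra.
  by lra.
Unshelve. all: by end_near. Qed.

Lemma is_derive_affine k c x : is_derive x 1 (fun x => k * x + c) k.
Proof.
have H := @is_deriveD _ _ _ _ _ _ _ _ _
  (@is_deriveZ _ _ _ id k x 1 _ (is_derive_id x 1)) (@is_derive_cst _ _ _ c x 1).
by apply: (is_derive_eq H); rewrite addr0 /GRing.scale /= mulr1.
Qed.

Lemma is_derive_tanh_affine k c x :
  is_derive x 1 (fun x => tanh (k * x + c)) (k * (1 - tanh (k * x + c) ^+ 2)).
Proof.
rewrite mulrC; exact: (@is_derive1_comp _ (@tanh R) (fun x => k * x + c) x _ _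
  (is_derive_tanh _) (is_derive_affine k c x)).
Qed.

Lemma tanh_affine_onto k c t : k != 0 -> -1 < t < 1 -> exists x, tanh (k * x + c) = t.
Proof.
move=> k0 t1; exists ((artanh t - c) / k).
by rewrite mulrC divfK// subrK artanhK.
Qed.

Lemma jacobi_weightB1 a b t : -1 < t < 1 ->
  jacobi_weight (a - 1) (b - 1) t * (1 - t ^+ 2) = jacobi_weight a b t.
Proof.
move=> t1; rewrite /jacobi_weight -{2}(subrK 1 a) -{2}(subrK 1 b) !powRSB1; [|lra..].
by ring.
Qed.

Lemma jacobi_weightD a b c d t : -1 < t < 1 ->
  jacobi_weight (a + c) (b + d) t = jacobi_weight a b t * jacobi_weight c d t.
Proof.
move=> t1; rewrite /jacobi_weight !powRD; [ring|..].
- by apply/implyP => _; apply: lt0r_neq0; lra.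
- by apply/implyP => _; apply: lt0r_neq0; lra.
Qed.

(** Because tanh' = 1 - tanh^2 restores the factor by which differentiation in t
    lowers the weight, functions w p(tanh) are stable under differentiation. *)
Lemma is_derive_weight_tanh (A B : R) (p : {poly R}) k c x :
  is_derive x 1
    (fun x => jacobi_weight A B (tanh (k * x + c)) * p.[tanh (k * x + c)])
    (k * (jacobi_weight A B (tanh (k * x + c)) *
      ((1 - 'X^2) * p^`() + (B *: (1 - 'X) - A *: (1 + 'X)) * p).[tanh (k * x + c)])).
Proof.
have T1 := tanh_itv (k * x + c).
have H := is_derive_weight_mul (A - 1) (B - 1) p T1.
rewrite /jacobi_drift !subrK in H.
apply: (is_derive_eq (@is_derive1_comp _ _ (fun x => tanh (k * x + c)) x _ _ H
  (is_derive_tanh_affine k c x))).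
by rewrite -(jacobi_weightB1 A B T1); ring.
Qed.

End HyperbolicTangent.

(** * Orthonormality of the systems psi *)

Section JacobiSystem.
Context {R : realType}.
Notation mu := (@lebesgue_measure R).
Implicit Types (a b x t k c : R) (m n : nat).

Definition orthonormal_jacobi a b m : {poly R} :=
  ((-1) ^+ m / Num.sqrt (jacobi_norm2 a b m)) *: jacobi a b m.

(** The form shared by all the systems: the square root of a weight times an
    orthonormal polynomial, evaluated at tanh x. *)
Lemma psiE a b m x : psi a b m x =
  jacobi_weight ((a + 1) / 2) ((b + 1) / 2) (tanh x) *
  (orthonormal_jacobi a b m).[tanh x].
Proof. by rewrite /psi /jacobi_weight /orthonormal_jacobi hornerZ; ring. Qed.

Lemma jacobi_norm2_gt0 a b m : -1 < a -> -1 < b -> 0 < jacobi_norm2 a b m.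
Proof. by move=> a1 b1; rewrite jacobi_norm2E jacobi_integral_sqr_gt0. Qed.

Lemma size_orthonormal_jacobi a b m : -1 < a -> -1 < b ->
  size (orthonormal_jacobi a b m) = m.+1.
Proof.
move=> a1 b1; rewrite size_scale ?size_jacobi// mulf_neq0 ?signr_eq0// invr_eq0.
by rewrite gt_eqF// sqrtr_gt0 jacobi_norm2_gt0.
Qed.

Lemma orthonormal_jacobi_integral a b m n : -1 < a -> -1 < b ->
  jacobi_integral a b (orthonormal_jacobi a b m * orthonormal_jacobi a b n) =
  (m == n)%:R.
Proof.
move=> a1 b1; rewrite -scalerAl -scalerAr !jacobi_integralZ//.
have [<-|mn] := eqVneq m n; last by rewrite jacobi_orthogonal// !mulr0.
have D0 := jacobi_norm2_gt0 m a1 b1.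
rewrite -expr2 -jacobi_norm2E mulrA -expr2 exprMn sqrr_sign mul1r exprVn.
by rewrite sqr_sqrtr ?mulVf ?gt_eqF// ltW.
Qed.

Lemma orthonormal_polys_jacobi a b : -1 < a -> -1 < b ->
  orthonormal_polys (jacobi_weight a b) (orthonormal_jacobi a b).
Proof.
move=> a1 b1; split.
- apply: open_continuous_measurable_fun; first exact: itv_open.
  by move=> t; rewrite inE /= in_itv; exact: continuous_jacobi_weight.
- by move=> t _; exact: jacobi_weight_ge0.
- by move=> m; exact: size_orthonormal_jacobi.
- move=> m n; have := integrable_weight_mul (orthonormal_jacobi a b m *
    orthonormal_jacobi a b n) a1 b1.
  by apply: eq_integrable => // t _ /=; rewrite hornerM mulrC.
- move=> m n; rewrite -(orthonormal_jacobi_integral m n a1 b1).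
  by apply: eq_Rintegral => t _; rewrite hornerM mulrC.
Qed.

Lemma jacobi_weight_half a b t : -1 < t < 1 ->
  jacobi_weight ((a + 1) / 2) ((b + 1) / 2) t ^+ 2 =
  jacobi_weight a b t * (1 - t ^+ 2).
Proof.
move=> t1; rewrite expr2 -jacobi_weightD// -!splitr.
by rewrite -(jacobi_weightB1 (a + 1) (b + 1) t1) !addrK.
Qed.

(** The factor sqrt k keeps the L_2 norm under the change of variables k x + c. *)
Definition affine_psi a b k c m x : R := Num.sqrt k * psi a b m (k * x + c).

Lemma affine_psiE a b k c m x : affine_psi a b k c m x =
  jacobi_weight ((a + 1) / 2) ((b + 1) / 2) (tanh (k * x + c)) *
  (Num.sqrt k *: orthonormal_jacobi a b m).[tanh (k * x + c)].
Proof. by rewrite /affine_psi psiE [in RHS]hornerZ; ring. Qed.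

Lemma affine_psiM a b k c m n x : 0 <= k ->
  affine_psi a b k c m x * affine_psi a b k c n x =
  jacobi_weight a b (tanh (k * x + c)) *
   (orthonormal_jacobi a b m * orthonormal_jacobi a b n).[tanh (k * x + c)] *
   (k * (1 - tanh (k * x + c) ^+ 2)).
Proof.
move=> k0; have T1 := tanh_itv (k * x + c).
rewrite /affine_psi !psiE hornerM.
have := jacobi_weight_half a b T1.
move: (jacobi_weight _ _ _) (jacobi_weight a b _) => w W wW.
transitivity (Num.sqrt k ^+ 2 * w ^+ 2 * (orthonormal_jacobi a b m).[tanh (k * x + c)]
  * (orthonormal_jacobi a b n).[tanh (k * x + c)]); first by ring.
by rewrite wW sqr_sqrtr//; ring.
Qed.

(** The substitution t = tanh (k x + c) in the weighted integral of p. *)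
Lemma affine_psi_substitution a b k c (p : {poly R}) : 0 < k -> -1 < a -> -1 < b ->
  let f x := jacobi_weight a b (tanh (k * x + c)) * p.[tanh (k * x + c)] *
     (k * (1 - tanh (k * x + c) ^+ 2)) in
  mu.-integrable setT (EFin \o f) /\ \int[mu]_x f x = jacobi_integral a b p.
Proof.
move=> k0 a1 b1 f.
have d0 x : 0 < k * (1 - tanh (k * x + c) ^+ 2).
  by rewrite mulr_gt0//; have := tanh_itv (k * x + c); nra.
have cd : continuous (fun x => k * (1 - tanh (k * x + c) ^+ 2)).
  have -> : (fun x => k * (1 - tanh (k * x + c) ^+ 2)) =
      (horner (k *: (1 - 'X^2))) \o (fun x => tanh (k * x + c)).
    by apply/funext => x; rewrite /= !hornerE.
  move=> x; apply: continuous_comp; last exact: continuous_horner.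
  exact: is_derive_continuous (is_derive_tanh_affine k c x).
have onto (t : R) : -1 < t < 1 -> exists x, tanh (k * x + c) = t.
  by apply: tanh_affine_onto; rewrite gt_eqF.
have cf (t : R) : -1 < t < 1 ->
    {for t, continuous (fun t => jacobi_weight a b t * p.[t])}.
  exact: continuous_weight_mul.
split.
  exact: (integrable_substitution_onto (is_derive_tanh_affine k c) d0 cd
    (fun x => tanh_itv _) onto cf (integrable_weight_mul p a1 b1)).
rewrite /jacobi_integral /Rintegral.
by rewrite (integral_substitution_onto (is_derive_tanh_affine k c) d0 cd
    (fun x => tanh_itv _) onto cf).
Qed.

Lemma Lfun2_of_integrable_sqr (f : R -> R) : measurable_fun setT f ->
  mu.-integrable setT (EFin \o (fun x => f x ^+ 2)) -> f \in Lfun mu 2%:E.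
Proof.
move=> mf /integrableP[_ fi]; rewrite inE; apply/andP; split; rewrite inE//=.
rewrite /finite_norm unlock /=; apply: poweR_lty; apply: le_lt_trans fi.
rewrite le_eqVlt; apply/orP; left; apply/eqP; apply: eq_integral => x _ /=.
by rewrite powR_mulrn// normrX.
Qed.

Lemma orthonormal_affine_psi a b k c : 0 < k -> -1 < a -> -1 < b ->
  orthonormal_system (affine_psi a b k c).
Proof.
move=> k0 a1 b1.
have E m n := affine_psi_substitution c (orthonormal_jacobi a b m *
   orthonormal_jacobi a b n) k0 a1 b1.
split => [m|m n]; last first.
  rewrite -(orthonormal_jacobi_integral m n a1 b1) -(E m n).2.
  by apply: eq_Rintegral => x _; rewrite affine_psiM// ltW.
apply: Lfun2_of_integrable_sqr.
  rewrite (funext (affine_psiE a b k c m)); apply: continuous_measurable_fun => x.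
  exact: is_derive_continuous (is_derive_weight_tanh _ _ _ _ _ _).
by apply: eq_integrable (E m m).1 => // x _ /=; rewrite -affine_psiM ?ltW// expr2.
Qed.

End JacobiSystem.

(** * Differentiation matrices *)

Section Admissible.
Context {R : realType}.
Notation mu := (@lebesgue_measure R).
Implicit Types (a b x t k c : R) (m n : nat).

(** Normalising two orthogonal functions of squared norms D and E makes a ladder with
    coefficients u and v skew-symmetric, with the geometric mean of u and v as its
    entry. *)
Lemma sqrt_ladder (u v D E : R) : u < 0 -> v < 0 -> 0 < D -> 0 < E ->
  u * E = v * D ->
  - u / Num.sqrt D = Num.sqrt (u * v) / Num.sqrt E /\
  - v / Num.sqrt E = Num.sqrt (u * v) / Num.sqrt D.
Proof.
move=> u0 v0 D0 E0 uE; have un : u != 0 by rewrite lt_eqF.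
have [r r0 vE] : exists2 r, 0 < r & v = u * r.
  by exists (v / u); [rewrite nmulr_rgt0// invr_lt0|rewrite mulrC divfK].
have -> : E = r * D by apply: (mulfI un); rewrite uE vE mulrA.
have -> : u * v = u ^+ 2 * r by rewrite vE mulrA.
rewrite (sqrtrM r (sqr_ge0 u)) (sqrtrM D (ltW r0)) sqrtr_sqr ltr0_norm//.
have sD : Num.sqrt D != 0 by rewrite gt_eqF// sqrtr_gt0.
have sr : Num.sqrt r != 0 by rewrite gt_eqF// sqrtr_gt0.
split; first by field; rewrite sr sD.
by rewrite vE -{1}(sqr_sqrtr (ltW r0)); field; rewrite sr sD.
Qed.

Lemma jacobi_coeff_gt0 a b m : -1 < a -> -1 < b -> 0 < jacobi_coeff a b m.
Proof.
move=> a1 b1; rewrite jacobi_coeffE// sqrtr_gt0 nmulr_rgt0 ?raise_coef_lt0//.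
exact: lower_coefS_lt0.
Qed.

Lemma jacobi_coeff_ladder a b m : -1 < a -> -1 < b ->
  let D n := Num.sqrt (jacobi_norm2 a b n) in
  - raise_coef a b m / D m = jacobi_coeff a b m / D m.+1 /\
  - lower_coef a b m.+1 / D m.+1 = jacobi_coeff a b m / D m.
Proof.
move=> a1 b1 D; rewrite jacobi_coeffE//; apply: sqrt_ladder.
- exact: raise_coef_lt0.
- exact: lower_coefS_lt0.
- exact: jacobi_norm2_gt0.
- exact: jacobi_norm2_gt0.
- by rewrite !jacobi_norm2E raise_lower_norm.
Qed.

Lemma orthonormal_jacobi_ladder a b m : -1 < a -> -1 < b ->
  (1 - 'X^2) * (orthonormal_jacobi a b m)^`() +
     2^-1 *: (jacobi_drift a b * orthonormal_jacobi a b m) =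
  - (if m is n.+1 then jacobi_coeff a b n *: orthonormal_jacobi a b n else 0) +
  jacobi_coeff a b m *: orthonormal_jacobi a b m.+1.
Proof.
move=> a1 b1; rewrite /orthonormal_jacobi; set s := (-1) ^+ m / _.
have -> : (1 - 'X^2) * (s *: jacobi a b m)^`() +
    2^-1 *: (jacobi_drift a b * (s *: jacobi a b m)) =
  s *: ((1 - 'X^2) * (jacobi a b m)^`() + 2^-1 *: (jacobi_drift a b * jacobi a b m)).
  by rewrite derivZ -!mul_polyC; ring.
rewrite {}/s.
have [Eu _] := jacobi_coeff_ladder m a1 b1.
have Hu : (-1) ^+ m / Num.sqrt (jacobi_norm2 a b m) * raise_coef a b m =
   jacobi_coeff a b m * ((-1) ^+ m.+1 / Num.sqrt (jacobi_norm2 a b m.+1)).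
  rewrite exprS; transitivity
    ((-1) ^+ m * - (- raise_coef a b m / Num.sqrt (jacobi_norm2 a b m))).
    by ring.
  by rewrite Eu; ring.
case: m Eu Hu => [|m] Eu Hu; first by rewrite jacobi_ladder0 !scalerA Hu oppr0 add0r.
rewrite jacobi_ladder// scalerBr !scalerA Hu addrC; congr (_ + _).
have [_ Ev] := jacobi_coeff_ladder m a1 b1.
congr (- (_ *: _)); rewrite exprS.
transitivity ((-1) ^+ m * (- lower_coef a b m.+1 / Num.sqrt (jacobi_norm2 a b m.+1))).
  by ring.
by rewrite Ev; ring.
Qed.

Lemma diff_matrix_affine_psi a b k c : 0 < k -> -1 < a -> -1 < b ->
  diff_matrix_coeffs (affine_psi a b k c) (fun m => k * jacobi_coeff a b m).
Proof.
move=> k0 a1 b1; split=> [m|m x]; first by rewrite mulr_gt0// jacobi_coeff_gt0.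
rewrite (funext (affine_psiE a b k c m)).
apply: (is_derive_eq (is_derive_weight_tanh _ _ _ _ _ _)).
set w := jacobi_weight _ _ _; set T := tanh _.
have -> : (1 - 'X^2) * (Num.sqrt k *: orthonormal_jacobi a b m)^`() +
    ((b + 1) / 2 *: (1 - 'X) - (a + 1) / 2 *: (1 + 'X)) *
    (Num.sqrt k *: orthonormal_jacobi a b m) =
  Num.sqrt k *: ((1 - 'X^2) * (orthonormal_jacobi a b m)^`() +
     2^-1 *: (jacobi_drift a b * orthonormal_jacobi a b m)).
  rewrite derivZ /jacobi_drift ![_ / 2]mulrC -!mul_polyC !polyCM; ring.
rewrite orthonormal_jacobi_ladder//.
case: m => [|m]; rewrite !affine_psiE -/T -/w !hornerE /=; ring.
Qed.

Lemma psi_affine a b : psi a b = affine_psi a b 1 0.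
Proof.
by apply/funext => m; apply/funext => x; rewrite /affine_psi sqrtr1 !mul1r addr0.
Qed.

Lemma range_map_tanh : range_map (@artanh R) tanh.
Proof.
have dh (t : R) : -1 < t < 1 -> artanh^`()%classic t = (1 - t ^+ 2)^-1.
  by move=> t1; have [_ <-] := is_derive_artanh t1; rewrite derive1E.
split.
- apply/seteqP; split => // x _; exists (tanh x); last exact: tanhK.
  by rewrite /= in_itv; exact: tanh_itv.
- by move=> t t1; case: (is_derive_artanh t1).
- apply: (@eq_measurable_fun _ _ _ _ _ (fun t : R => (1 - t ^+ 2)^-1)).
    by move=> t; rewrite inE /= in_itv => t1; rewrite dh.
  apply: open_continuous_measurable_fun; first exact: itv_open.
  move=> t; rewrite inE /= in_itv /= => t1.
  have -> : (fun t : R => (1 - t ^+ 2)^-1) = (fun t : R => ((1 - 'X^2).[t])^-1).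
    by apply/funext => s; rewrite !hornerE.
  apply: cvgV; last exact: continuous_horner.
  by rewrite !hornerE; apply/eqP; nra.
- by move=> t t1; rewrite dh// invr_gt0; nra.
- exact: tanh_itv.
- exact: artanhK.
- exact: tanhK.
- by move=> x; case: (is_derive_tanh x).
- move=> t t1; rewrite dh// derive1E; have [_ ->] := is_derive_tanh (artanh t).
  by rewrite artanhK// mulVf//; apply/eqP; nra.
Qed.

(** theta is the inverse of the square root of W / h', so the essentially bounded
    function of the definition is the indicator of (-1, 1). *)
Lemma full_range_psi a b : -1 < a -> -1 < b -> full_range_form (psi a b).
Proof.
move=> a1 b1; have [ho hd hm h0 Hr hK HK Hd hH] := range_map_tanh.
exists (jacobi_weight a b), (orthonormal_jacobi a b), artanh, tanh,
  (jacobi_weight (- ((a + 1) / 2)) (- ((b + 1) / 2))); split.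
- exact: orthonormal_polys_jacobi.
- exact: range_map_tanh.
- set f := (fun t : R => _).
  have -> : f = \1_(`](-1 : R), 1[%classic).
    apply/funext => t; rewrite /f indicE; case: ifPn => t1; last first.
      by rewrite memNset// /= in_itv /= ; apply/negP.
    rewrite mem_set; last by rewrite /= in_itv.
    rewrite derive1E; have [_ ->] := is_derive_artanh t1.
    rewrite invrK -jacobi_weight_half// sqrtr_sqr ger0_norm ?jacobi_weight_ge0//.
    by rewrite -jacobi_weightD// !addNr /jacobi_weight !powRr0 mulr1.
  rewrite inE; apply/andP; split; rewrite inE /=; first exact: measurable_indic.
  rewrite /finite_norm unlock /=; case: ifP => // _.
  apply: (@le_lt_trans _ _ 1%E); last exact: ltry.
  apply/ess_supP; apply: nearW => t /=; rewrite lee_fin indicE.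
  by case: (t \in _); rewrite ?normr1 ?normr0.
- move=> m x; rewrite psiE; congr (_ * _).
  rewrite derive1E; have [_ ->] := is_derive_tanh x.
  have T1 := tanh_itv x.
  rewrite -mulrA (mulrC (1 - _)) -jacobi_weight_half// expr2 mulrA -jacobi_weightD//.
  by rewrite !addNr /jacobi_weight !powRr0 !mul1r.
Qed.

Lemma admissible_psi a b : -1 < a -> -1 < b -> admissible_system (psi a b).
Proof.
move=> a1 b1; split; last exists (fun m => 1 * jacobi_coeff a b m).
- by rewrite psi_affine; exact: orthonormal_affine_psi.
- exact: full_range_psi.
- by rewrite psi_affine; exact: diff_matrix_affine_psi.
Qed.

Lemma is_derive_unique (f : R -> R) x d d' :
  is_derive x 1 f d -> is_derive x 1 f d' -> d = d'.
Proof. by move=> [_ <-] [_ <-]. Qed.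

(** Each step of the three-term recurrence produces b m times the next function,
    whose norm is 1, so both b m > 0 and that function can be read off. *)
Lemma diff_matrix_unique (phi chi : nat -> R -> R) (b c : nat -> R) :
  orthonormal_system phi -> orthonormal_system chi ->
  diff_matrix_coeffs phi b -> diff_matrix_coeffs chi c ->
  phi 0%N = chi 0%N -> forall m, phi m = chi m /\ b m = c m.
Proof.
move=> [phi2 phiI] [chi2 chiI] [b0 dphi] [c0 dchi] E0.
have scale m : (forall x, b m * phi m.+1 x = c m * chi m.+1 x) ->
    phi m.+1 = chi m.+1 /\ b m = c m.
  move=> E; have bn : b m != 0 by rewrite gt_eqF.
  have phiE x : phi m.+1 x = c m / b m * chi m.+1 x.
    by apply: (mulfI bn); rewrite E; field.
  have := phiI m.+1 m.+1; rewrite eqxx.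
  have -> : \int[mu]_x (phi m.+1 x * phi m.+1 x) =
     (c m / b m) ^+ 2 * \int[mu]_x (chi m.+1 x * chi m.+1 x).
    rewrite -RintegralZl//.
      by apply: eq_Rintegral => x _; rewrite phiE; ring.
    by have := Lfun2_integrable_sqr (chi2 m.+1); under eq_fun do rewrite expr2.
  rewrite chiI eqxx mulr1 => /eqP; rewrite sqrf_eq1 => /orP[] /eqP r1.
    have cb : c m = b m by rewrite -[LHS](divfK bn) r1 mul1r.
    by split => //; apply/funext => x; rewrite phiE r1 mul1r.
  have : 0 < c m / b m by rewrite divr_gt0.
  by rewrite r1 ltr0N1.
have step m : phi m = chi m ->
    (forall x, (if m is j.+1 then b j * phi j x else 0) =
               (if m is j.+1 then c j * chi j x else 0)) ->
    phi m.+1 = chi m.+1 /\ b m = c m.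
  move=> Em Eprev; apply: scale => x.
  have := dphi m x; rewrite Em => D1.
  have := is_derive_unique D1 (dchi m x); rewrite Eprev; exact: addrI.
have all m : phi m = chi m /\ (phi m.+1 = chi m.+1 /\ b m = c m).
  elim: m => [|m [IH1 [IH2 IH3]]]; first by split => //; apply: step.
  by split => //; apply: step => // x; rewrite IH1 IH3.
by move=> m; have [H1 [_ H2]] := all m.
Qed.

End Admissible.

(** * Classification *)

Section Classification.
Context {R : realType}.
Notation mu := (@lebesgue_measure R).
Implicit Types (x t k c : R) (m n : nat).

Lemma is_derive_expRM k x : is_derive x 1 (fun x => expR (k * x)) (k * expR (k * x)).
Proof.
have H1 : is_derive x 1 (fun x => k * x) k.
  have H := @is_deriveZ _ _ _ id k x 1 _ (is_derive_id x 1).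
  by apply: (is_derive_eq H); rewrite /GRing.scale /= mulr1.
have H2 : is_derive (k * x) 1 (@expR R) (expR (k * x)) by exact: is_derive_expR.
by rewrite mulrC; exact: (@is_derive1_comp _ (@expR R) (fun x => k * x) x _ _ H2 H1).
Qed.

Lemma linear_ode_sqr_expR (f l : R -> R) k x :
  is_derive x 1 f (f x * l x) ->
  is_derive x 1 (fun x => f x ^+ 2 * expR (k * x))
    (f x ^+ 2 * expR (k * x) * (2 * l x + k)).
Proof.
move=> df; have H := @is_deriveM _ _ _ _ _ _ _ _ (@is_deriveM _ _ _ _ _ _ _ _ df df)
  (is_derive_expRM k x).
have -> : (fun x => f x ^+ 2 * expR (k * x)) = f * f * (fun x => expR (k * x)).
  by apply/funext => y; rewrite !mulrfctE expr2.
by apply: (is_derive_eq H); rewrite mulrfctE /GRing.scale /=; ring.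
Qed.

(** A uniqueness statement without existence theory: f^2 exp (2 K x) is
    nondecreasing and f^2 exp (- 2 K x) nonincreasing, so a zero of f spreads to its left
    and to its right. *)
Lemma linear_ode_zero (f l : R -> R) (K z : R) :
  (forall x, is_derive x 1 f (f x * l x)) -> (forall x, `|l x| <= K) ->
  f z = 0 -> forall x, f x = 0.
Proof.
move=> df lK fz x.
have up k : 2 * K <= k -> x <= z -> f x = 0.
  move=> Kk xz; have dP y := @linear_ode_sqr_expR f l k y (df y).
  have := @is_derive_le _ _ _ dP _ x z xz.
  rewrite fz expr0n /= mul0r => H.
  have : f x ^+ 2 * expR (k * x) <= 0.
    apply: H => y; apply: mulr_ge0.
      by apply: mulr_ge0; [exact: sqr_ge0|exact: expR_ge0].
    by have := lK y; rewrite ler_norml => /andP[h1 h2]; lra.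
  by rewrite pmulr_lle0 ?expR_gt0// => h; apply/eqP; rewrite -sqrf_eq0 eq_le h sqr_ge0.
have dn k : k <= - (2 * K) -> z <= x -> f x = 0.
  move=> Kk zx.
  have dN y := @is_deriveN _ _ _ _ _ _ _ (@linear_ode_sqr_expR f l k y (df y)).
  have := @is_derive_le _ _ _ dN _ z x zx.
  rewrite !opprfctE fz expr0n /= mul0r oppr0 => H.
  have : 0 <= - (f x ^+ 2 * expR (k * x)).
    apply: H => y; rewrite -mulrN; apply: mulr_ge0.
      by apply: mulr_ge0; [exact: sqr_ge0|exact: expR_ge0].
    by have := lK y; rewrite ler_norml => /andP[h1 h2]; lra.
  rewrite oppr_ge0 pmulr_lle0 ?expR_gt0// => h.
  by apply/eqP; rewrite -sqrf_eq0 eq_le h sqr_ge0.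
by have [xz|/ltW zx] := leP x z; [exact: up xz|exact: dn zx].
Qed.

(** If Q did not vanish at 1, then H would increase at a speed bounded below once it
    is close to 1, and so exceed 1 in finite time. *)
Lemma autonomous_ode_root1 (H : R -> R) (Q : {poly R}) :
  (forall x, is_derive x 1 H Q.[H x]) -> (forall x, 0 < Q.[H x]) ->
  (forall x, -1 < H x < 1) -> (forall t, -1 < t < 1 -> exists x, H x = t) ->
  Q.[1] = 0.
Proof.
move=> dH Q0 H1 onto; apply/eqP/negP => /negP Q1.
pose e := `|Q.[1]| / 2; have e0 : 0 < e by rewrite divr_gt0// normr_gt0.
have /cvgrPdist_lt/(_ e e0)/nbhs_ballP[d /= d0 Hd] := @continuous_horner _ Q 1.
pose t0 := 1 - Num.min (d / 2) 1.
have mind : 0 < Num.min (d / 2) 1 <= 1.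
  by rewrite lt_min divr_gt0// ltr01 ge_min lexx orbT.
have mind2 : Num.min (d / 2) 1 < d by rewrite gt_min ltr_pdivrMr// ltr_pMr// ltr1n.
have [x0 Hx0] : exists x, H x = t0 by apply: onto; rewrite /t0; lra.
have Hmono := is_derive_le dH (fun x => ltW (Q0 x)).
have Qe x : x0 <= x -> e <= Q.[H x].
  move=> xx; have Hx := Hmono _ _ xx; rewrite Hx0 /t0 in Hx.
  have /Hd : ball (1 : R) d (H x).
    by rewrite /ball /= ger0_norm; have := H1 x; lra.
  rewrite /= => h; rewrite -(gtr0_norm (Q0 x)).
  have := ler_normB Q.[1] (Q.[1] - Q.[H x]).
  rewrite opprB addrCA subrr addr0 /e => h2.
  have := ler_normD (Q.[1] - Q.[H x]) Q.[H x]; rewrite subrK /e in h *; lra.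
(* at speed e, the time 2 / e suffices to cross (-1, 1) *)
pose x1 := x0 + 2 / e.
have x01 : x0 <= x1 by rewrite lerDl divr_ge0// ltW.
have cH : {within `[x0, x1], continuous H}.
  by apply: continuous_subspaceT => y; exact: is_derive_continuous (dH y).
have [z] := @MVT_segment _ H (fun x => Q.[H x]) _ _ x01 (fun x _ => dH x) cH.
rewrite in_itv /= => /andP[xz _].
have -> : x1 - x0 = 2 / e by rewrite /x1 addrC addKr.
have : e * (2 / e) <= Q.[H z] * (2 / e).
  by rewrite ler_wpM2r ?Qe// divr_ge0// ltW.
rewrite mulrCA divff ?gt_eqF// mulr1.
by have := H1 x0; have := H1 x1; move=> h1 h2 h3 h4; lra.
Qed.

(** The reflection x to - x, H to - H reduces this end to the other one. *)
Lemma autonomous_ode_rootN1 (H : R -> R) (Q : {poly R}) :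
  (forall x, is_derive x 1 H Q.[H x]) -> (forall x, 0 < Q.[H x]) ->
  (forall x, -1 < H x < 1) -> (forall t : R, -1 < t < 1 -> exists x, H x = t) ->
  Q.[-1] = 0.
Proof.
move=> dH Q0 H1 onto; have QN t : (Q \Po (- 'X)).[t] = Q.[- t].
  by rewrite horner_comp !hornerE.
have := @autonomous_ode_root1 (fun x => - H (- x)) (Q \Po (- 'X)).
rewrite QN; apply.
- move=> x; rewrite QN opprK.
  have Hx : is_derive (- x) 1 H Q.[H (- x)] := dH (- x).
  have D := @is_derive1_comp _ H (fun y => - y) x _ _ Hx (is_deriveNid x 1).
  by apply: (is_derive_eq (@is_deriveN _ _ _ _ _ _ _ D)); rewrite mulrN1 opprK.
- by move=> x; rewrite QN opprK.
- by move=> x; have := H1 (- x); lra.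
- move=> t t1; have [x Hx] : exists x, H x = - t by apply: onto; lra.
  by exists (- x); rewrite opprK Hx opprK.
Qed.

Lemma size3_horner (Q : {poly R}) t : (size Q <= 3)%N -> Q.[1] = 0 -> Q.[-1] = 0 ->
  Q.[t] = Q.[0] * (1 - t ^+ 2).
Proof.
move=> sQ.
have E x : Q.[x] = Q`_0 + Q`_1 * x + Q`_2 * x ^+ 2.
  by rewrite (horner_coef_wide _ sQ) !big_ord_recr big_ord0 /= add0r expr0 mulr1 expr1.
rewrite !E => h1 h2.
have q1 : Q`_1 = 0 by lra.
have q2 : Q`_2 = - Q`_0 by lra.
by rewrite q1 q2; ring.
Qed.

(** artanh H has the constant derivative k. *)
Lemma logistic_ode_tanh (H : R -> R) k :
  (forall x, is_derive x 1 H (k * (1 - H x ^+ 2))) -> (forall x, -1 < H x < 1) ->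
  forall x, H x = tanh (k * x + artanh (H 0)).
Proof.
move=> dH H1 x; rewrite -{1}(artanhK (H1 x)); congr tanh.
pose f x := artanh (H x) - k * x.
suff -> : artanh (H x) = f x + k * x.
  rewrite [f x](@is_derive_0_is_cst _ f x 0).
    by rewrite /f mulr0 subr0 addrC.
  move=> y.
  have D1 := @is_derive1_comp _ (@artanh R) H y _ _ (is_derive_artanh (H1 y)) (dH y).
  have D2 := is_derive_affine k 0 y.
  have -> : f = (@artanh R \o H) - (fun x => k * x + 0).
    by apply/funext => z; rewrite /f -[in LHS](addr0 (k * z)).
  apply: (is_derive_eq (@is_deriveB _ _ _ _ _ _ _ _ _ D1 D2)).
  have : 1 - H y ^+ 2 != 0 by apply/eqP; have := H1 y; nra.
  by move=> h; field.
by rewrite /f subrK.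
Qed.

(** A polynomial L of degree at most 1 is a combination of 1 - t and 1 + t, and then f
    divided by the corresponding weight has derivative zero. *)
Lemma weight_ode_solution (f : R -> R) (L : {poly R}) k c : k != 0 -> (size L <= 2)%N ->
  (forall x, is_derive x 1 f (f x * L.[tanh (k * x + c)])) ->
  exists A B C, forall x, f x = C * jacobi_weight A B (tanh (k * x + c)).
Proof.
move=> k0 sL df; pose A := - L.[1] / (2 * k); pose B := L.[-1] / (2 * k).
have LE t : L.[t] = k * (B * (1 - t) - A * (1 + t)).
  have E x : L.[x] = L`_0 + L`_1 * x.
    rewrite (horner_coef_wide _ sL) !big_ord_recr big_ord0 /=.
    by rewrite add0r expr0 mulr1 expr1.
  by rewrite /A /B !E; field.
pose T x := tanh (k * x + c); have T1 x : -1 < T x < 1 by exact: tanh_itv.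
pose g x := f x * jacobi_weight (- A) (- B) (T x).
exists A, B, (g 0) => x.
suff -> : g 0 = g x.
  by rewrite /g -mulrA -jacobi_weightD// !addNr /jacobi_weight !powRr0 !mulr1.
apply: is_derive_0_is_cst => y; have D := is_derive_weight_tanh (- A) (- B) 1 k c y.
have -> : g = f * (fun x => jacobi_weight (- A) (- B) (tanh (k * x + c)) *
    (1 : {poly R}).[tanh (k * x + c)]).
  by apply/funext => z; rewrite /g mulrfctE -polyC1 hornerC mulr1.
apply: (is_derive_eq (@is_deriveM _ _ _ _ _ _ _ _ (df y) D)).
rewrite derivC mulr0 add0r mulr1 LE !hornerE /GRing.scale /= /jacobi_weight; ring.
Qed.

Lemma not_integrable_ge_cst (f : R -> R) (S : set R) (e : R) :
  measurable S -> mu S = +oo%E -> 0 < e -> (forall x, S x -> e <= f x) ->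
  ~ mu.-integrable setT (EFin \o f).
Proof.
move=> mS muS e0 ef fi.
have fS : mu.-integrable S (EFin \o f).
  by exact: (@integrableS _ _ _ mu _ _ _ measurableT mS (@subsetT _ S) fi).
have /integrableP[_] : mu.-integrable S (EFin \o cst e).
  apply: (@le_integrable _ _ _ mu _ mS _ _ _ _ fS).
    by apply/measurable_EFinP; exact: measurable_cst.
  move=> x Sx /=; rewrite lee_fin (gtr0_norm e0).
  exact: le_trans (ef _ Sx) (ler_norm _).
rewrite (_ : (fun x => _) = cst e%:E).
  have -> : (\int[mu]_(x in S) cst e%:E x = e%:E * mu S)%E by exact: integral_cst.
  by rewrite muS gt0_muley ?lte_fin// ltxx.
by apply/funext => x /=; rewrite gtr0_norm.
Qed.

Lemma jacobi_weight_lower A B t : A <= 0 -> 0 <= t < 1 ->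
  2 `^ (- `|B|) <= jacobi_weight A B t.
Proof.
move=> A0 t1; rewrite /jacobi_weight -[leLHS]mul1r ler_pM ?powR_ge0//.
  rewrite -[leLHS](powRr0 (1 - t)) ger_powR//; lra.
rewrite powRN -[B in leRHS]opprK powRN lef_pV2 ?posrE ?powR_gt0//; last lra.
by rewrite -normrN powR_le_exp2//; lra.
Qed.

Lemma jacobi_weight_reflect A B t : jacobi_weight A B (- t) = jacobi_weight B A t.
Proof. by rewrite /jacobi_weight opprK mulrC. Qed.

Lemma tanh_ge0 x : 0 <= x -> 0 <= tanh x.
Proof.
move=> x0; rewrite tanhE; have : 1 <= expR (2 * x) by rewrite -expR0 ler_expR mulr_ge0.
by move=> h; rewrite divr_ge0//; lra.
Qed.

Lemma tanhN x : tanh (- x) = - tanh x.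
Proof. by rewrite /tanh opprK -mulNr opprB addrC [X in _ / X]addrC. Qed.

(** An exponent A <= 0 keeps the weight away from 0 on the half-line where tanh is
    nonnegative, and likewise for B on the other half-line. *)
Lemma weight_tanh_integrable_exponents A B k c : 0 < k ->
  mu.-integrable setT
    (EFin \o (fun x => jacobi_weight A B (tanh (k * x + c)) ^+ 2)) ->
  0 < A /\ 0 < B.
Proof.
move=> k0 Wi; have e0 (C : R) : 0 < (2 `^ (- `|C|)) ^+ 2 :> R.
  by rewrite exprn_gt0// powR_gt0.
split; rewrite ltNge; apply/negP => le0.
- apply: (@not_integrable_ge_cst _ `[- c / k, +oo[%classic _ _ _ (e0 B) _ Wi) => //.
    by rewrite lebesgue_measure_itv /= ltry.
  move=> x; rewrite /= in_itv /= andbT => xc.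
  rewrite lerXn2r ?nnegrE ?powR_ge0 ?jacobi_weight_ge0// jacobi_weight_lower//.
  have /andP[_ ->] := tanh_itv (k * x + c); rewrite tanh_ge0//.
  by rewrite mulrC -lerBlDr sub0r -ler_pdivrMr.
- apply: (@not_integrable_ge_cst _ `]-oo, - c / k]%classic _ _ _ (e0 A) _ Wi) => //.
    by rewrite lebesgue_measure_itv /= ltNyr.
  move=> x; rewrite /= in_itv /= => xc.
  rewrite -[tanh _]opprK jacobi_weight_reflect -tanhN.
  rewrite lerXn2r ?nnegrE ?powR_ge0 ?jacobi_weight_ge0// jacobi_weight_lower//.
  have /andP[_ ->] := tanh_itv (- (k * x + c)); rewrite tanh_ge0//.
  by rewrite oppr_ge0 mulrC -lerBrDr sub0r -ler_pdivlMr.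
Qed.

Lemma orthonormal_system_sign (phi : nat -> R -> R) (e : R) :
  e ^+ 2 = 1 -> orthonormal_system phi ->
  orthonormal_system (fun m x => e * phi m x).
Proof.
move=> e2 [phi2 phiI]; split => [m|m n].
  have n12 : 1 <= 2 :> R by rewrite ler1n.
  have -> : (fun x => e * phi m x) = e \o* phi m.
    by apply/funext => x /=; rewrite mulrC.
  exact: Lfun_scale n12 (phi2 m).
rewrite -phiI; apply: eq_Rintegral => x _.
by rewrite -[RHS]mul1r -e2; ring.
Qed.

Lemma diff_matrix_sign (phi : nat -> R -> R) (b : nat -> R) (e : R) :
  diff_matrix_coeffs phi b -> diff_matrix_coeffs (fun m x => e * phi m x) b.
Proof.
move=> [b0 dphi]; split => // m x.
apply: (is_derive_eq (@is_deriveZ _ _ _ _ e _ _ _ (dphi m x))).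
by rewrite /GRing.scale /=; case: m => [|m]; ring.
Qed.

(** The equations for phi 0 and phi 1 determine Th and H, hence phi 0 up to sign, and
    diff_matrix_unique extends the identification to all m. *)
Theorem admissible_classification (phi : nat -> R -> R) : admissible_system phi ->
  exists alpha beta a c eps : R,
    [/\ -1 < alpha /\ -1 < beta, 0 < a, eps = 1 \/ eps = -1 &
      forall (m : nat) (x : R),
        phi m x = eps * Num.sqrt a * psi alpha beta m (a * x + c)].
Proof.
move=> [phiON [W [q [h [H [theta [qW hH _ phiE]]]]]] [b [b0 dphi]]].
have [phi2 phiI] := phiON.
have sq := poly_degree qW.
pose Th x := theta (H x) * H^`()%classic x * W (H x).
have {}phiE m x : phi m x = Th x * (q m).[H x] by exact: phiE.
have H1 := H_range hH.
(* the equation for phi 0 *)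
pose q0 := (q 0%N)`_0.
have q0C : q 0%N = q0%:P by apply: size1_polyC; rewrite sq.
have q00 : q0 != 0 by rewrite -polyC_eq0 -q0C -size_poly_eq0 sq.
have phi0 x : phi 0%N x = Th x * q0 by rewrite phiE q0C hornerC.
pose L := (b 0%N / q0) *: q 1%N.
have dTh x : is_derive x 1 Th (Th x * L.[H x]).
  have ThE : Th = q0^-1 \*: phi 0%N.
    by apply/funext => y; rewrite /= phi0 /GRing.scale /= mulrCA mulVf// mulr1.
  rewrite {1}ThE.
  apply: (is_derive_eq (@is_deriveZ _ _ _ _ q0^-1 _ _ _ (dphi 0%N x))).
  by rewrite /GRing.scale /= phiE oppr0 add0r hornerZ; field.
have Th0 x : Th x != 0.
  apply/eqP => Thx; have [K HK] := poly_bounded L.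
  have Th00 := linear_ode_zero dTh (fun y => HK _ (H1 y)) Thx.
  have := phiI 0%N 0%N.
  have -> : (fun x => phi 0%N x * phi 0%N x) = cst 0.
    by apply/funext => y; rewrite phi0 Th00 !mul0r.
  by rewrite Rintegral_cst// mul0r eqxx => /eqP; rewrite eq_sym oner_eq0.
(* the equation for phi 1, divided by Th *)
pose d := (q 1%N)`_1.
have q1' t : (q 1%N)^`().[t] = d.
  have -> : (q 1%N)^`() = d%:P; last by rewrite hornerC.
  apply/polyP => -[|i]; rewrite coef_deriv coefC /= ?mulr1n//.
  by rewrite nth_default ?mul0rn// sq.
have d0 : d != 0.
  have : lead_coef (q 1%N) != 0 by rewrite lead_coef_eq0 -size_poly_eq0 sq.
  by rewrite lead_coefE sq.
pose Q := d^-1 *: (b 1%N *: q 2%N - b 0%N *: q 0%N - L * q 1%N).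
have sL : (size L <= 2)%N by rewrite (leq_trans (size_scale_leq _ _))// sq.
have sQ : (size Q <= 3)%N.
  rewrite (leq_trans (size_scale_leq _ _))// (leq_trans (size_polyD _ _))// geq_max.
  rewrite (leq_trans (size_polyD _ _))/=; last first.
    rewrite geq_max size_polyN.
    by rewrite !(leq_trans (size_scale_leq _ _))// sq.
  rewrite size_polyN (leq_trans (size_polyMleq _ _))// sq.
  by case: (size L) sL => [|[|[|]]].
have dH x : is_derive x 1 H Q.[H x].
  have HD : is_derive x 1 H (H^`()%classic x).
    by rewrite derive1E; apply: DeriveDef => //; exact: (H_derivable hH).
  suff -> : Q.[H x] = H^`()%classic x by [].
  have Hq : is_derive (H x) 1 (horner (q 1%N)) d.
    by apply: (is_derive_eq (is_derive_poly (q 1%N) (H x))); rewrite q1'.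
  have D1 := @is_deriveM _ _ _ _ _ _ _ _ (dTh x)
    (@is_derive1_comp _ (horner (q 1%N)) H x _ _ Hq HD).
  have D2 := dphi 1%N x.
  have E : phi 1%N = Th * (horner (q 1%N) \o H).
    by apply/funext => y; rewrite phiE.
  rewrite E in D2; have := is_derive_unique D1 D2.
  rewrite /GRing.scale /= !phiE => E2; apply: (mulfI d0); apply: (mulfI (Th0 x)).
  have -> : d * Q.[H x] =
      b 1%N * (q 2%N).[H x] - b 0%N * (q 0%N).[H x] - L.[H x] * (q 1%N).[H x].
    by rewrite /Q hornerZ mulrA divff// mul1r !(hornerD, hornerN, hornerM, hornerZ).
  transitivity (- (b 0%N * (Th x * (q 0%N).[H x])) + b 1%N * (Th x * (q 2%N).[H x])
    - (q 1%N).[H x] * (Th x * L.[H x])); first by ring.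
  by rewrite -E2 /=; ring.
have Q0 x : 0 < Q.[H x].
  have [_ <-] := dH x; rewrite -derive1E.
  have := hH_derive hH (H1 x); rewrite (HK hH) => E.
  by rewrite -(pmulr_rgt0 _ (h_derive_gt0 hH (H1 x))) E ltr01.
have onto (t : R) : -1 < t < 1 -> exists x, H x = t.
  by move=> t1; exists (h t); exact: (hK hH).
have QE t := size3_horner t sQ (autonomous_ode_root1 dH Q0 H1 onto)
  (autonomous_ode_rootN1 dH Q0 H1 onto).
pose a := Q.[0]; pose c := artanh (H 0).
have a0 : 0 < a.
  have [x Hx] : exists x, H x = 0 by apply: onto; lra.
  by have := Q0 x; rewrite Hx.
have HT x : H x = tanh (a * x + c).
  by apply: (@logistic_ode_tanh H a _ H1) => y; rewrite -QE; exact: dH.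
have [A [B [C ThE]]] : exists A B C, forall x,
    Th x = C * jacobi_weight A B (tanh (a * x + c)).
  by apply: (weight_ode_solution (lt0r_neq0 a0) sL) => x; rewrite -HT.
have C0 : C * q0 != 0.
  by rewrite mulf_neq0//; apply: contra_neq (Th0 0) => C0; rewrite ThE C0 mul0r.
have phi0E x : phi 0%N x = C * q0 * jacobi_weight A B (tanh (a * x + c)).
  by rewrite phi0 ThE mulrAC.
have [A0 B0] : 0 < A /\ 0 < B.
  apply: (weight_tanh_integrable_exponents (c := c) a0).
  have := @integrableZl _ _ _ mu _ measurableT ((C * q0) ^- 2) _
    (Lfun2_integrable_sqr (phi2 0%N)).
  apply: eq_integrable => // x _ /=; rewrite -EFinM phi0E; congr EFin.
  by move: (C * q0) C0 => z z0; field.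
pose alpha := 2 * A - 1; pose beta := 2 * B - 1.
have al1 : -1 < alpha by rewrite /alpha; lra.
have be1 : -1 < beta by rewrite /beta; lra.
pose e := C * q0 / (Num.sqrt a / Num.sqrt (jacobi_norm2 alpha beta 0)).
have sa : Num.sqrt a != 0 by rewrite gt_eqF// sqrtr_gt0.
have sD : Num.sqrt (jacobi_norm2 alpha beta 0) != 0.
  by rewrite gt_eqF// sqrtr_gt0 jacobi_norm2_gt0.
have phi0e x : phi 0%N x = e * affine_psi alpha beta a c 0 x.
  rewrite affine_psiE phi0E /orthonormal_jacobi jacobi0 expr0 !hornerZ -polyC1 hornerC.
  have -> : (alpha + 1) / 2 = A by rewrite /alpha; field.
  have -> : (beta + 1) / 2 = B by rewrite /beta; field.
  by rewrite /e; field; rewrite sa sD.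
have affON := orthonormal_affine_psi c a0 al1 be1.
have e2 : e ^+ 2 = 1.
  have : \int[mu]_x (phi 0%N x * phi 0%N x) =
      e ^+ 2 * \int[mu]_x (affine_psi alpha beta a c 0 x *
        affine_psi alpha beta a c 0 x).
    rewrite -RintegralZl//.
      by apply: eq_Rintegral => x _; rewrite phi0e; ring.
    by have := Lfun2_integrable_sqr (affON.1 0%N); under eq_fun do rewrite expr2.
  by rewrite phiI affON.2 eqxx mulr1 => <-.
have U := diff_matrix_unique phiON (orthonormal_system_sign e2 affON) (conj b0 dphi)
  (diff_matrix_sign e (diff_matrix_affine_psi c a0 al1 be1)) (funext phi0e).
exists alpha, beta, a, c, e; split => //.
  by move/eqP: e2; rewrite sqrf_eq1 => /orP[] /eqP ->; [left|right].
by move=> m x; rewrite (U m).1 /affine_psi mulrA.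
Qed.

End Classification.

Unset Implicit Arguments.

Theorem theorem2p1 (R : realType) :
  (forall phi : nat -> R -> R, admissible_system phi ->
     exists alpha beta a c eps : R,
       [/\ -1 < alpha /\ -1 < beta, 0 < a, eps = 1 \/ eps = -1 &
           forall (m : nat) (x : R),
             phi m x = eps * Num.sqrt a * psi alpha beta m (a * x + c)]) /\
  (forall alpha beta : R, -1 < alpha -> -1 < beta ->
     admissible_system (psi alpha beta) /\
     (forall b : nat -> R, diff_matrix_coeffs (psi alpha beta) b ->
        forall m : nat, b m = jacobi_coeff alpha beta m)).
Proof.
split; first exact: admissible_classification.
move=> alpha beta al1 be1; split; first exact: admissible_psi.
move=> b db m; have [psiON _ _] := admissible_psi al1 be1.
have D := diff_matrix_affine_psi 0 (@ltr01 R) al1 be1.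
rewrite -psi_affine in D.
by have [_ ->] := diff_matrix_unique psiON psiON db D erefl m; rewrite mul1r.
Qed.
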